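(* Let $d=2$, $\theta\in(0,1]$, $\Delta t>0$. Suppose that the mesh $\mathcal{T}_h$ satisfies the Delaunay-type mesh condition: for every interior edge $e_{ij}$, $$\frac12\left[\widetilde\alpha_{i_K,j_K}^K+\operatorname{arccot}\!\left(\sqrt{\tfrac{\det(\mathbb{D}_K)}{\det(\mathbb{D}_{K'})}}\cot(\widetilde\alpha_{i_K,j_K}^K)\right)+\widetilde\alpha_{i_{K'},j_{K'}}^{K'}+\operatorname{arccot}\!\left(\sqrt{\tfrac{\det(\mathbb{D}_{K'})}{\det(\mathbb{D}_K)}}\cot(\widetilde\alpha_{i_{K'},j_{K'}}^{K'})\right)\right]\le\pi,$$ and that the time step size satisfies $$\Delta t\ \le\ \frac1{3(1-\theta)}\min_i\frac{|\omega_i|}{\sum_{K\in\omega_i}|K|\,\lambda_{\max}(\mathbb{D}_K)\,(h_{i_K}^K)^{-2}},$$ where the minimum is taken over all interior vertices $\boldsymbol{a}_i$. Then the lumped-mass scheme $$\left(\begin{bmatrix}\bar M_{11}&0\\0&I\end{bmatrix}+\theta\Delta t\begin{bmatrix}A_{11}&A_{12}\\0&0\end{bmatrix}\right)\boldsymbol{u}^{n+1}=\left(\begin{bmatrix}\bar M_{11}&0\\0&0\end{bmatrix}-(1-\theta)\Delta t\begin{bmatrix}A_{11}&A_{12}\\0&0\end{bmatrix}\right)\boldsymbol{u}^n+\Delta t\,\boldsymbol{f}^{n+\theta},\quad n=0,\dots,N-1,$$ with $\boldsymbol{u}^0=(u_0(\boldsymbol{a}_1),\dots,u_0(\boldsymbol{a}_{N_v}))^T$,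 satisfies a discrete maximum principle: whenever $f(\boldsymbol{x},t)\le 0$ in $\Omega_T$, its solution satisfies $$\max_{n=0,\dots,N}\ \max_{\boldsymbol{x}\in\overline{\Omega}}U^n(\boldsymbol{x})\ =\ \max\Big\{0,\ \max_{n=1,\dots,N}\ \max_{\boldsymbol{x}\in\partial\Omega}U^n(\boldsymbol{x}),\ \max_{\boldsymbol{x}\in\overline{\Omega}}U^0(\boldsymbol{x})\Big\},$$ where $U^n(\boldsymbol{x})=\sum_{j=1}^{N_v}u_j^n\phi_j(\boldsymbol{x})$.
   Context: Problem. $\Omega\subset\mathbb{R}^2$ is a connected polygonal domain, $T>0$, $\Omega_T=\Omega\times(0,T]$. The problem being discretized is $u_t-\nabla\cdot(\mathbb{D}\nabla u)=f(\boldsymbol{x},t)$ in $\Omega_T$, $u=g(\boldsymbol{x},t)$ on $\partial\Omega\times[0,T]$, $u(\boldsymbol{x},0)=u_0(\boldsymbol{x})$ in $\Omega$, with given functions $f,g,u_0$ and a symmetric, strictly positive definite matrix-valued function $\mathbb{D}=\mathbb{D}(\boldsymbol{x})$ independent of time. Data are assumed regular enough that the integrals and point values below make sense. Mesh. $\mathcal{T}_h$ is a (conforming) triangulation of $\Omega$ with vertices $\boldsymbol{a}_1,\dots,\boldsymbol{a}_{N_v}$, ordered so that the first $N_{vi}$ are the interior vertices (the others lie on $\partial\Omega$). $\phi_j$ is the continuous piecewise linear basis function associated with $\boldsymbol{a}_j$. $|K|$ is the area of $K$ and $\mathbb{D}_K=\frac1{|K|}\int_K\mathbb{D}\,d\boldsymbol{x}$;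 $\lambda_{\max}(\mathbb{D}_K)$ is its largest eigenvalue. $\omega_i$ is the patch of elements having $\boldsymbol{a}_i$ as a vertex and $|\omega_i|$ its area. For an element $K$ containing $\boldsymbol{a}_i$, $i_K$ is the local index of $\boldsymbol{a}_i$ on $K$, and $h_{i_K}^K$ is the distance from $\boldsymbol{a}_i$ to the line containing the edge of $K$ opposite $\boldsymbol{a}_i$. Angles. For an interior edge $e_{ij}$ with endpoints $\boldsymbol{a}_i,\boldsymbol{a}_j$, $K$ and $K'$ are the two elements sharing it; $\widetilde\alpha_{i_K,j_K}^K\in(0,\pi)$ is the angle of $K$ opposite $e_{ij}$ measured in the metric $\mathbb{D}_K^{-1}$, i.e. the corresponding (Euclidean) angle of the triangle $\mathbb{D}_K^{-1/2}K$; $\widetilde\alpha_{i_{K'},j_{K'}}^{K'}$ is defined likewise for $K'$ with $\mathbb{D}_{K'}$. $\operatorname{arccot}$ is the inverse of $\cot:(0,\pi)\to\mathbb{R}$. Scheme ($\theta$-method in time, linear finite elements with lumped mass in space). For $i=1,\dots,N_{vi}$, $j=1,\dots,N_v$ let $$m_{ij}=\sum_{K\in\mathcal{T}_h}\int_K\phi_j\phi_i\,d\boldsymbol{x},\qquad a_{ij}=\sum_{K\in\mathcal{T}_h}|K|(\nabla\phi_i|_K)^T\mathbb{D}_K\nabla\phi_j|_K,$$ $f_i(t)=\sum_{K}\int_K f(\boldsymbol{x},t)\phi_i\,d\boldsymbol{x}$; $[A_{11}\ A_{12}]=(a_{ij})$, partitioned by columns $1,\dots,N_{vi}$ and $N_{vi}+1,\dots,N_v$;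 $\bar M_{11}$ is the $N_{vi}\times N_{vi}$ diagonal (lumped mass) matrix with diagonal entries $\bar m_{ii}=\sum_{j=1}^{N_v}m_{ij}$; $I$ is the identity matrix of size $N_v-N_{vi}$; and $$\boldsymbol{f}^{n+\theta}=\Big(f_1(t_n+\theta\Delta t),\dots,f_{N_{vi}}(t_n+\theta\Delta t),\tfrac1{\Delta t}g(\boldsymbol{a}_{N_{vi}+1},t_{n+1}),\dots,\tfrac1{\Delta t}g(\boldsymbol{a}_{N_v},t_{n+1})\Big)^T,$$ where $t_n=n\Delta t$, $N\ge1$ is the number of time steps, $N\Delta t\le T$, and $\boldsymbol{u}^n=(u_1^n,\dots,u_{N_v}^n)^T$. Convention. When $\theta=1$ the upper bound on $\Delta t$ is $+\infty$, i.e. no constraint.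
   Formalization: The printed equality fails when all values are negative (f = 0, g = u_0 = -1: left side -1, right side 0); the formal theorem also takes the maximum with 0 on the left-hand side, which gives the printed equality whenever the left-hand maximum is nonnegative. *)

(* Defs.v *)
From HB Require Import structures.
From mathcomp Require Import all_boot all_order all_algebra.
From mathcomp Require Import all_classical all_reals all_analysis.

Set Implicit Arguments.
Unset Strict Implicit.
Unset Printing Implicit Defensive.

Import Order.TTheory GRing.Theory Num.Theory.
Import numFieldNormedType.Exports.

Local Open Scope classical_set_scope.
Local Open Scope ring_scope.

Notation leb2 R := ((@lebesgue_measure R) \x (@lebesgue_measure R))%E.

(* The plane is R * R, so that the product measure and topology of the library
   apply; vectors acted on by matrices are columns. *)
Section plane.
Context {R : realType}.
Implicit Types (x y z : R * R) (A : set (R * R)) (M : 'M[R]_2).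

Definition colv x : 'cV[R]_2 := \col_i (if i == 0 then x.1 else x.2).

Definition bilin M (v w : 'cV[R]_2) : R := (v^T *m M *m w) 0 0.

(* The norm of the normed space R * R is the max norm. *)
Definition enorm x : R := Num.sqrt (x.1 ^+ 2 + x.2 ^+ 2).

Definition area A : R := fine (leb2 R A).

Definition boundary A : set (R * R) := closure A `\` interior A.

Definition segment x y : set (R * R) :=
  [set (1 - s) *: x + s *: y | s in `[0, 1]].

Definition polygonal_domain (Om : set (R * R)) : Prop :=
  [/\ open Om, Om !=set0, connected Om, bounded_set Om &
      exists s : seq ((R * R) * (R * R)),
        boundary Om = \bigcup_(e in [set` s]) segment e.1 e.2].

Definition spd M : Prop :=
  M^T = M /\ forall v : 'cV[R]_2, v != 0 -> 0 < bilin M v v.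

(* Angle at z of the triangle x y z in the inner product given by M. *)
Definition angle M x y z : R :=
  let p := colv (x - z) in let q := colv (y - z) in
  acos (bilin M p q / (Num.sqrt (bilin M p p) * Num.sqrt (bilin M q q))).

Definition lambda_max M : R := sup [set l : R | eigenvalue M l].

Definition cot (t : R) : R := cos t / sin t.

Definition arccot (s : R) : R := get [set t : R | 0 < t < pi /\ cot t = s].

Definition has_grad A (F : R * R -> R) (v : 'cV[R]_2) : Prop :=
  exists c : R, forall x, A x -> F x = (v^T *m colv x) 0 0 + c.

(* Meaningful when F is affine on A and A is not contained in a line: then
   exactly one v satisfies has_grad A F v. *)
Definition grad A (F : R * R -> R) : 'cV[R]_2 := xget 0 (has_grad A F).

End plane.

(* Simplices are given by sets of vertex indices. *)
Section simplex.
Context {R : realType} {I : finType}.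
Implicit Types (a : I -> R * R) (S : {set I}).

Definition affine_span a S : set (R * R) :=
  [set x | exists l : I -> R, [/\ forall j, j \notin S -> l j = 0,
     \sum_j l j = 1 & x = \sum_j l j *: a j]].

Definition hull a S : set (R * R) :=
  [set x | exists l : I -> R, [/\ forall j, j \notin S -> l j = 0,
     forall j, 0 <= l j, \sum_j l j = 1 & x = \sum_j l j *: a j]].

End simplex.

(* Conforming triangulation of Om: ni interior vertices, numbered first, and
   nb boundary vertices. *)
Record triangulation (R : realType) (Om : set (R * R)) (ni nb : nat) :=
  Triangulation {
    vtx : 'I_(ni + nb) -> R * R;
    elts : {set {set 'I_(ni + nb)}};
    vtx_inj : injective vtx;
    elts_card : forall K, K \in elts -> #|K| = 3%N;
    elts_nondegenerate : forall i j k, [set i; j; k]%SET \in elts ->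
      (vtx j - vtx i).1 * (vtx k - vtx i).2
        - (vtx j - vtx i).2 * (vtx k - vtx i).1 != 0;
    elts_cover : closure Om = \bigcup_(K in [set` elts]) hull vtx K;
    elts_conforming : forall K K', K \in elts -> K' \in elts ->
      hull vtx K `&` hull vtx K' = hull vtx (K :&: K')%SET;
    vtx_used : forall i, exists2 K, K \in elts & i \in K;
    vtx_interior : forall i : 'I_ni, Om (vtx (lshift nb i));
    vtx_boundary : forall i : 'I_nb, boundary Om (vtx (rshift ni i))
  }.

Section scheme.
Context {R : realType} {Om : set (R * R)} {ni nb : nat}.
Variable Th : triangulation Om ni nb.
Local Notation nv := (ni + nb)%N.
Implicit Types (K : {set 'I_nv}) (i j k : 'I_nv) (D : R * R -> 'M[R]_2).

Definition elt K : set (R * R) := hull (vtx Th) K.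

Definition meanD D K : 'M[R]_2 :=
  \matrix_(p, q) ((area (elt K))^-1 * \int[leb2 R]_(x in elt K) D x p q).

Definition patch i : {set {set 'I_nv}} := [set K in elts Th | i \in K]%SET.

Definition patch_area i : R := area (\bigcup_(K in [set` patch i]) elt K).

Definition height K i : R :=
  inf [set enorm (vtx Th i - y) | y in affine_span (vtx Th) (K :\ i)%SET].

Definition nodal_basis (phi : 'I_nv -> R * R -> R) : Prop :=
  forall j, [/\ {within closure Om, continuous (phi j)},
    forall K, K \in elts Th -> exists v, has_grad (elt K) (phi j) v &
    forall i, phi j (vtx Th i) = (i == j)%:R].

(* For K = {i, j, k}, the angle of K opposite to the edge ij in the metric
   given by the inverse of the mean of D over K. *)
Definition opp_angle D i j k : R :=
  angle (invmx (meanD D [set i; j; k]%SET)) (vtx Th i) (vtx Th j) (vtx Th k).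

Definition delaunay_type D : Prop :=
  forall i j k k',
    let K := [set i; j; k]%SET in let K' := [set i; j; k']%SET in
    K \in elts Th -> K' \in elts Th -> k != k' ->
    ~ (segment (vtx Th i) (vtx Th j) `<=` boundary Om) ->
    let al := opp_angle D i j k in let al' := opp_angle D i j k' in
    let d := \det (meanD D K) in let d' := \det (meanD D K') in
    1 / 2 * (al + arccot (Num.sqrt (d / d') * cot al)
             + al' + arccot (Num.sqrt (d' / d) * cot al')) <= pi.

Definition time_step_bound D (theta : R) : \bar R :=
  if theta == 1 then +oo%E else
  ((1 / (3 * (1 - theta)))%:E *
   \big[Order.min/+oo]_(i < ni)
     (patch_area (lshift nb i) /
      \sum_(K in patch (lshift nb i))
        area (elt K) * lambda_max (meanD D K)
          * (height K (lshift nb i)) ^- 2)%:E)%E.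

Variable phi : 'I_nv -> R * R -> R.

Definition mass i j : R :=
  \sum_(K in elts Th) \int[leb2 R]_(x in elt K) (phi j x * phi i x).

Definition stiff D i j : R :=
  \sum_(K in elts Th)
    area (elt K) * bilin (meanD D K) (grad (elt K) (phi i))
                                     (grad (elt K) (phi j)).

Definition load (f : R * R -> R -> R) (t : R) i : R :=
  \sum_(K in elts Th) \int[leb2 R]_(x in elt K) (f x t * phi i x).

Definition lumped_mass : 'M[R]_ni :=
  diag_mx (\row_i \sum_(j < nv) mass (lshift nb i) j).

Definition stiffness D : 'M[R]_(ni, nv) :=
  \matrix_(i, j) stiff D (lshift nb i) j.

Definition rhs (f g : R * R -> R -> R) (theta dt : R) (n : nat) : 'cV[R]_nv :=
  col_mx (\col_i load f (n%:R * dt + theta * dt) (lshift nb i))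
         (\col_j (1 / dt * g (vtx Th (rshift ni j)) (n.+1%:R * dt))).

Definition lumped_scheme D (f g : R * R -> R -> R) (u0 : R * R -> R)
    (theta dt : R) (N : nat) (u : nat -> 'cV[R]_nv) : Prop :=
  let A11 := lsubmx (stiffness D) in let A12 := rsubmx (stiffness D) in
  u 0%N = \col_j u0 (vtx Th j) /\
  forall n, (n < N)%N ->
    (block_mx lumped_mass 0 0 1%:M
       + (theta * dt) *: block_mx A11 A12 0 0) *m u n.+1
    = (block_mx lumped_mass 0 0 0
       - ((1 - theta) * dt) *: block_mx A11 A12 0 0) *m u n
      + dt *: rhs f g theta dt n.

Definition fem_fun (u : 'cV[R]_nv) (x : R * R) : R :=
  \sum_(j < nv) u j 0 * phi j x.

End scheme.

(* Main.v *)
(* Row [i] of the scheme gives a maximum principle as soon as a_ij <= 0 for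
   j <> i, the row sums of the stiffness matrix vanish,
   (1 - theta) dt a_ii <= \bar m_ii and f <= 0: at the interior node where the
   new iterate is largest the implicit terms are nonnegative, and the explicit
   terms form a nonnegative combination of old nodal values.

   On a triangle with vertices a_i, a_j, a_k, writing [p = a_i - a_k] and
   [q = a_j - a_k],
     |K| grad phi_i . D_K grad phi_j
       = - (|K| / |p x q|) sqrt (det D_K) cot (angle at a_k for D_K^-1),
   and |K| / |p x q| does not depend on K, since affine maps scale area by
   their determinant.  Conformity forces exactly two triangles, on opposite
   sides, around an edge issued from an interior vertex, so the sign of a_ij
   is that of minus a sum of two weighted cotangents, which the angle
   condition makes nonnegative.  The time step bound follows from
   \int_K phi_i = |K| / 3, |grad phi_i| = 1 / h_i and the Rayleigh quotient. *)

(* Three features of the setting shape the argument. First, [D] and [f] have a sign only on the open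
   set [Om], while the elements fill its closure. The boundary is a finite union of segments, hence
   null, so positivity of the mean matrices and the sign of the loads are obtained almost everywhere
   on each element. Second, the mesh carries no adjacency data: conformity is only an identity
   between intersections of hulls, so the triangle across an edge must be produced by moving a point
   off the edge, close enough to an interior endpoint to stay in [Om]. Third, the angle condition
   averages two inequalities that are equivalent to each other. Pairing an angle with the
   arccotangent of the rescaled cotangent of the opposite one, each pair is at most [pi] exactly
   when the same weighted sum of cotangents is nonnegative; a negative sum would push both pairs
   above [pi] at once. *)
Require Import Defs.
From HB Require Import structures.
From mathcomp Require Import all_boot all_order all_algebra.
From mathcomp Require Import all_classical all_reals all_analysis.
From mathcomp Require Import measurable_realfun ring lra.

Set Implicit Arguments.
Unset Strict Implicit.
Unset Printing Implicit Defensive.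

Import Order.TTheory GRing.Theory Num.Theory.
Import numFieldNormedType.Exports.

Local Open Scope classical_set_scope.
Local Open Scope ring_scope.

(** * Affine changes of variables in the plane *)

Section affine_change.
Context {R : realType}.
Local Notation leb := (@lebesgue_measure R).
Local Notation mR := (measurableTypeR R).
Implicit Types (a b c d e : R).

Lemma measurable_affine a b : measurable_fun [set: mR] (fun x : mR => (a * x + b : mR)).
Proof.
by apply: measurable_funD => //; apply: measurable_funM.
Qed.

(** Uniqueness of Lebesgue measure: [|a|] times the pushforward gives half-open intervals their
    length. A negative [a] swaps the open and closed ends, hence the two cases. *)
Lemma lebesgue_measure_affine a b (A : set mR) : a != 0 -> measurable A ->
  leb ((fun x : R => a * x + b) @^-1` A) = ((`|a|^-1)%:E * leb A)%E.
Proof.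
move=> a0 mA.
have mf := measurable_affine a b.
have an : 0 <= `|a| by [].
rewrite [in RHS](@lebesgue_measure_unique _ (mscale (NngNum an)
  (pushforward leb (fun x : mR => (a * x + b : mR))))) //.
  by rewrite /mscale/= /pushforward muleA -EFinM mulVf ?normr_eq0// mul1e.
move=> X [[u v] uv <-] /=.
rewrite /mscale/= /pushforward.
have := a0; rewrite neq_lt => /orP[a_lt0|a_gt0].
  have -> : (fun x : mR => a * x + b : mR) @^-1` `]u, v]%classic =
      `[(v - b) / a, (u - b) / a[%classic.
    apply/seteqP; split=> x /=; rewrite !in_itv/= ler_ndivrMr// ltr_ndivlMr//;
     rewrite (mulrC x); move=> /andP[h1 h2]; apply/andP; split; lra.
  rewrite !lebesgue_measure_itv/= !lte_fin ltr_ndivrMr// mulfVK// ltrD2r.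
  case: ifP => _; rewrite ?mule0// -!EFinB -EFinM; congr (_%:E).
  by rewrite ltr0_norm//; field.
have -> : (fun x : mR => a * x + b : mR) @^-1` `]u, v]%classic =
    `](u - b) / a, (v - b) / a]%classic.
  apply/seteqP; split=> x /=; rewrite !in_itv/= ler_pdivlMr// ltr_pdivrMr//;
   rewrite (mulrC x); move=> /andP[h1 h2]; apply/andP; split; lra.
rewrite !lebesgue_measure_itv/= !lte_fin ltr_pdivrMr// mulfVK// ltrD2r.
case: ifP => _; rewrite ?mule0// -!EFinB -EFinM; congr (_%:E).
by rewrite gtr0_norm//; field.
Qed.

Lemma ge0_integral_affine a b (g : mR -> \bar R) : a != 0 ->
  measurable_fun [set: mR] g -> (forall x, (0 <= g x)%E) ->
  (\int[leb]_x g (a * x + b)%R = (`|a|^-1)%:E * \int[leb]_x g x)%E.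
Proof.
move=> a0 mg g0.
have mf := measurable_affine a b.
have an : 0 <= `|a|^-1 by rewrite invr_ge0.
have <- := @ge0_integral_mscale _ _ R leb _ measurableT (NngNum an) g mg (fun x _ => g0 x).
transitivity (\int[pushforward leb (fun x : mR => (a * x + b)%R : mR)]_x g x)%E.
  by rewrite ge0_integral_pushforward.
apply: eq_measure_integral => A mA _.
by rewrite /mscale/= /pushforward lebesgue_measure_affine.
Qed.

Local Notation R2 := (mR * mR)%type.

(** Phrased with preimages so that it composes and matches pushforward measures; for an affine map
    the factor is therefore the inverse of the absolute determinant. *)
Definition scales_area (k : R) (T : R2 -> R2) :=
  measurable_fun setT T /\
  forall A, measurable A -> leb2 R (T @^-1` A) = (k%:E * leb2 R A)%E.

Lemma scales_area_comp k l S T : scales_area k S -> scales_area l T ->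
  scales_area (k * l) (T \o S).
Proof.
move=> [mS hS] [mT hT]; split; first exact: measurableT_comp.
move=> A mA; rewrite comp_preimage hS; last first.
  by rewrite -[X in measurable X]setTI; exact: mT.
by rewrite hT// EFinM muleA.
Qed.

(** Uniqueness of the product measure: the pushforward under the swap agrees with it on
    rectangles. *)
Lemma scales_area_swap : scales_area 1 (fun x => (x.2, x.1)).
Proof.
have ms : measurable_fun [set: R2] (fun x : R2 => (x.2, x.1) : R2).
  exact: measurable_swap.
split => // A mA; rewrite mul1e; apply/esym.
have := @product_measure_unique _ _ mR mR R leb leb
  (pushforward (leb2 R) (fun x : R2 => (x.2, x.1) : R2)).
rewrite /pushforward; apply => // X Y mX mY.
change (leb2 R ((fun x : R2 => (x.2, x.1) : R2) @^-1` (X `*` Y)) = (leb X * leb Y)%E).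
rewrite (_ : _ @^-1` _ = Y `*` X); first by rewrite product_measure1E// muleC.
by apply/seteqP; split=> -[x y] []/=.
Qed.

(** Fubini on vertical sections: each section of the preimage is an affine preimage of a section of
    [A], which gives [1/|d|]; the substitution in the first coordinate gives [1/|a|]. *)
Lemma scales_area_triangular a b c d e : a != 0 -> d != 0 ->
  scales_area (`|a * d|^-1) (fun x => (a * x.1 + b, c * x.1 + d * x.2 + e)).
Proof.
move=> a0 d0.
have mT : measurable_fun [set: R2]
    (fun x => (a * x.1 + b, c * x.1 + d * x.2 + e) : R2).
  apply: measurable_fun_pair.
    by apply: measurable_funD => //; apply: measurable_funM.
  apply: measurable_funD => //; apply: measurable_funD;
    by apply: measurable_funM.
split => // A mA; rewrite /product_measure1.
under eq_integral => x _.
  rewrite /= (_ : xsection _ _ =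
      (fun y : R => d * y + (c * x + e)) @^-1` xsection A (a * x + b)); last first.
    apply/seteqP; split => y; rewrite /xsection/= !inE/= => h.
      by rewrite addrA (addrC (d * y)).
    by rewrite addrA (addrC (d * y)) in h.
  rewrite lebesgue_measure_affine//; last exact: measurable_xsection.
  over.
rewrite /= ge0_integralZl//; last first.
  apply: (measurableT_comp (measurable_fun_xsection _ mA)).
  exact: measurable_affine.
rewrite (ge0_integral_affine b a0 (measurable_fun_xsection leb mA))//.
by rewrite muleA -EFinM normrM invfM mulrC.
Qed.
End affine_change.

(** * Triangles and barycentric coordinates *)

Section triangle.
Context {R : realType}.
Local Notation leb := (@lebesgue_measure R).
Local Notation mR := (measurableTypeR R).
Local Notation R2 := (mR * mR)%type.
Implicit Types (p q a b c x : R * R).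

Definition cross p q : R := p.1 * q.2 - p.2 * q.1.

Lemma fstD a b : (a + b).1 = a.1 + b.1. Proof. by []. Qed.
Lemma sndD a b : (a + b).2 = a.2 + b.2. Proof. by []. Qed.
Lemma fstN a : (- a).1 = - a.1. Proof. by []. Qed.
Lemma sndN a : (- a).2 = - a.2. Proof. by []. Qed.
Lemma fstZ (k : R) a : (k *: a).1 = k * a.1. Proof. by []. Qed.
Lemma sndZ (k : R) a : (k *: a).2 = k * a.2. Proof. by []. Qed.
Definition pairE := (fstD, sndD, fstN, sndN, fstZ, sndZ).

(* Bruhat decomposition: a matrix with nonzero upper right entry is triangular,
   then swap, then triangular. *)
Lemma scales_area_affine p q c : cross p q != 0 ->
  scales_area (`|cross p q|^-1)
    (fun s : R2 => (s.1 * p.1 + s.2 * q.1 + c.1, s.1 * p.2 + s.2 * q.2 + c.2)).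
Proof.
rewrite /cross => pq0; have [q10|q10] := eqVneq q.1 0.
  move: pq0; rewrite q10 mulr0 subr0 mulf_eq0 negb_or => /andP[p10 q20].
  have := scales_area_triangular c.1 p.2 c.2 p10 q20.
  by congr scales_area; apply/funext => s; congr pair; ring.
(* The remaining pivot after elimination with [q.1]; it equals [- cross p q / q.1]. *)
have r0 : p.2 - q.2 * p.1 / q.1 != 0.
  rewrite (_ : _ - _ = - (p.1 * q.2 - p.2 * q.1) / q.1); last by field.
  by rewrite mulf_neq0 ?invr_eq0// oppr_eq0.
have h1 := scales_area_triangular 0 p.1 0 (oner_neq0 R) q10.
have h2 := scales_area_triangular c.1 (q.2 / q.1) c.2 (oner_neq0 R) r0.
have := scales_area_comp (scales_area_comp h1 scales_area_swap) h2.
congr scales_area; last by apply/funext => s; congr pair => /=; field.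
rewrite mulr1 !mul1r -invfM -normrM -(normrN (_ - _)); congr (`|_|^-1).
by field.
Qed.

Lemma ge0_integral_scales_area (k : R) (T : R2 -> R2) (D : set R2) (f : R2 -> \bar R) :
  0 <= k -> scales_area k T -> measurable D -> measurable_fun D f ->
  (forall x, D x -> (0 <= f x)%E) ->
  (\int[leb2 R]_(x in T @^-1` D) f (T x) = k%:E * \int[leb2 R]_(x in D) f x)%E.
Proof.
move=> k0 [mT hT] mD mf f0.
have <- := @ge0_integral_mscale _ _ R (leb2 R) D mD (NngNum k0) f mf f0.
transitivity (\int[pushforward (leb2 R) T]_(x in D) f x)%E.
  by rewrite ge0_integral_pushforward// => x /set_mem/f0.
apply: eq_measure_integral => A mA _.
by rewrite /mscale/= /pushforward hT.
Qed.

Definition tri a b c : set (R * R) :=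
  [set x | exists l : R * R * R, [/\ 0 <= l.1.1, 0 <= l.1.2, 0 <= l.2,
     l.1.1 + l.1.2 + l.2 = 1 & x = l.1.1 *: a + l.1.2 *: b + l.2 *: c]].

Lemma triC a b c : tri a b c = tri b c a.
Proof.
apply/seteqP; split=> _ [[[l1 l2] l3] /= [h1 h2 h3 h ->]].
  by exists (l2, l3, l1); split => //=; [rewrite -h addrC addrA|rewrite -addrA addrC].
by exists (l3, l1, l2); split => //=; [rewrite -h -addrA addrC|rewrite addrC addrA].
Qed.

Definition det3 a b c : R := cross (b - a) (c - a).

Lemma det3C a b c : det3 a b c = det3 b c a.
Proof. by rewrite /det3 /cross !pairE; ring. Qed.

(** Cramer's rule: the barycentric coordinate at [a] is the ratio of signed areas with [x] in place
    of [a]. The coordinates at [b] and [c] come from cyclic permutation. *)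
Definition bary a b c x : R := det3 x b c / det3 a b c.

Lemma bary_sum a b c x : det3 a b c != 0 ->
  bary a b c x + bary b c a x + bary c a b x = 1.
Proof.
move=> d0; rewrite /bary -(det3C a b c) (det3C c a b).
rewrite -!mulrDl -[RHS](divff d0); congr (_ / _).
by rewrite /det3 /cross !pairE; ring.
Qed.

Lemma bary_combo a b c x : det3 a b c != 0 ->
  x = bary a b c x *: a + bary b c a x *: b + bary c a b x *: c.
Proof.
rewrite /bary -(det3C a b c) (det3C c a b) => d0.
apply/eqP; rewrite -pair_eqE /pair_eq !pairE.
by apply/andP; split; apply/eqP; apply: (mulfI d0); rewrite /det3 /cross !pairE in d0 *;
  field.
Qed.

Lemma baryE a b c (l1 l2 l3 : R) : det3 a b c != 0 -> l1 + l2 + l3 = 1 ->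
  bary a b c (l1 *: a + l2 *: b + l3 *: c) = l1.
Proof.
move=> d0 h; rewrite /bary -[RHS](mulfK d0); congr (_ / _).
rewrite (_ : l3 = 1 - l1 - l2); last by rewrite -h; ring.
by rewrite /det3 /cross !pairE; ring.
Qed.

Lemma triP a b c x : det3 a b c != 0 ->
  tri a b c x <-> [/\ 0 <= bary a b c x, 0 <= bary b c a x & 0 <= bary c a b x].
Proof.
move=> d0; split.
  move=> [[[l1 l2] l3] /= [h1 h2 h3 h ->]]; split.
  - by rewrite baryE.
  - rewrite -addrA addrC baryE//; first by rewrite -det3C.
    by rewrite -h addrC addrA.
  - rewrite addrC addrA baryE//; first by rewrite det3C.
    by rewrite -h -addrA addrC.
move=> [h1 h2 h3]; exists (bary a b c x, bary b c a x, bary c a b x).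
by split => //=; [exact: bary_sum|exact: bary_combo].
Qed.

Definition aff (v : R * R) (k : R) x : R := v.1 * x.1 + v.2 * x.2 + k.

Lemma measurable_aff v k (D : set R2) : measurable_fun D (aff v k : R2 -> mR).
Proof.
apply: measurable_funTS; apply: measurable_funD => //.
by apply: measurable_funD; apply: measurable_funM.
Qed.

Lemma bary_aff a b c : bary a b c =
  aff ((b.2 - c.2) / det3 a b c, (c.1 - b.1) / det3 a b c)
      (cross b c / det3 a b c).
Proof.
apply/funext => x; rewrite /bary /aff /=.
rewrite -!mulrA ![_^-1 * _]mulrC !mulrA -!mulrDl; congr (_ / _).
by rewrite /det3 /cross !pairE; ring.
Qed.

Lemma measurable_bary a b c (D : set R2) :
  measurable_fun D (bary a b c : R2 -> mR).
Proof. by rewrite bary_aff; exact: measurable_aff. Qed.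

Lemma triE a b c : det3 a b c != 0 ->
  tri a b c = [set x | 0 <= bary a b c x] `&` [set x | 0 <= bary b c a x] `&`
              [set x | 0 <= bary c a b x].
Proof.
move=> d0; apply/seteqP; split => x.
  by move=> /(triP _ d0)[].
by case=> [[h1 h2] h3]; apply/triP.
Qed.

Lemma measurable_ge0 (f : R2 -> mR) : measurable_fun setT f ->
  measurable [set x | 0 <= f x].
Proof.
move=> mf; rewrite (_ : mkset _ = setT `&` f @^-1` `[0, +oo[%classic).
  by apply: mf.
by apply/seteqP; split => x /=; rewrite in_itv/= andbT => // -[].
Qed.

Lemma measurable_tri a b c : det3 a b c != 0 -> measurable (tri a b c : set R2).
Proof.
move=> d0; rewrite triE//; apply: measurableI; first apply: measurableI;
  by apply: measurable_ge0; exact: measurable_bary.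
Qed.
End triangle.

(** * Areas and integrals over a triangle, by pullback to the reference triangle *)

Section triangle_integral.
Context {R : realType}.
Local Notation leb := (@lebesgue_measure R).
Local Notation mR := (measurableTypeR R).
Local Notation R2 := (mR * mR)%type.
Implicit Types (p q a b c x : R * R).

Definition ref_tri : set R2 := [set s | [/\ 0 <= s.1, 0 <= s.2 & s.1 + s.2 <= 1]].

(** Its value (1/6) is never computed; finiteness and positivity are enough, because areas enter
    only through ratios and signs. *)
Definition ref_moment : \bar R := (\int[leb2 R]_(s in ref_tri) (s.1)%:E)%E.

Definition ref_map a b c (s : R2) : R2 :=
  (s.1 * (a - c).1 + s.2 * (b - c).1 + c.1,
   s.1 * (a - c).2 + s.2 * (b - c).2 + c.2).

Lemma ref_mapE a b c s :
  ref_map a b c s = s.1 *: a + s.2 *: b + (1 - s.1 - s.2) *: c.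
Proof.
rewrite [RHS]surjective_pairing !pairE.
by congr pair; rewrite !pairE; ring.
Qed.

Lemma ref_map_bary a b c s : det3 a b c != 0 ->
  [/\ bary a b c (ref_map a b c s) = s.1, bary b c a (ref_map a b c s) = s.2 &
      bary c a b (ref_map a b c s) = 1 - s.1 - s.2].
Proof.
move=> d0.
have h1 : bary a b c (ref_map a b c s) = s.1 by rewrite ref_mapE baryE//; ring.
have h2 : bary b c a (ref_map a b c s) = s.2.
  by rewrite ref_mapE -addrA addrC baryE//; [rewrite -det3C|ring].
by split=> //; rewrite -(bary_sum (ref_map a b c s) d0) h1 h2; ring.
Qed.

Lemma preimage_tri a b c : det3 a b c != 0 ->
  ref_map a b c @^-1` tri a b c = ref_tri.
Proof.
move=> d0; apply/seteqP; split => s /=.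
  move=> /(triP _ d0); have [-> -> ->] := ref_map_bary s d0.
  by move=> [h1 h2 h3]; split => //; lra.
move=> [h1 h2 h3]; apply/(triP _ d0); have [-> -> ->] := ref_map_bary s d0.
by split => //; lra.
Qed.

Lemma integral_baryE a b c : det3 a b c != 0 ->
  (\int[leb2 R]_(x in tri a b c) (bary a b c x)%:E
   = `|det3 a b c|%:E * ref_moment)%E.
Proof.
move=> d0.
have d0' : cross (a - c) (b - c) != 0 by rewrite -[cross _ _]/(det3 c a b) det3C.
have dE : cross (a - c) (b - c) = det3 a b c by rewrite -[cross _ _]/(det3 c a b) det3C.
have := @ge0_integral_scales_area R _ (ref_map a b c) (tri a b c)
  (EFin \o bary a b c) _ (scales_area_affine c d0') (measurable_tri d0).
rewrite preimage_tri// dE => h.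
rewrite /ref_moment.
transitivity (`|det3 a b c|%:E * \int[leb2 R]_(x in ref_tri) (EFin \o bary a b c) (ref_map a b c x))%E.
  rewrite h ?invr_ge0//.
  - by rewrite muleA -EFinM divff ?normr_eq0// mul1e.
  - by apply/measurable_EFinP; exact: measurable_bary.
  - by move=> x /(triP _ d0)[+ _ _] /=; rewrite lee_fin.
congr (_ * _)%E; apply: eq_integral => s _ /=.
by have [-> _ _] := ref_map_bary s d0.
Qed.

Lemma ref_moment_ge0 : (0 <= ref_moment)%E.
Proof. by apply: integral_ge0 => s [h _ _]; rewrite lee_fin. Qed.

(** Integrate the identity stating that the three barycentric coordinates sum to 1. By cyclic
    symmetry the three integrals coincide; this is the origin of the factor 3 in the lumped mass. *)
Lemma leb2_triE a b c : det3 a b c != 0 ->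
  (leb2 R (tri a b c) = `|det3 a b c|%:E * (3%:E * ref_moment))%E.
Proof.
move=> d0; have d1 := d0; have d2 := d0; rewrite det3C in d1; rewrite -det3C in d2.
have mt := measurable_tri d0.
have -> : leb2 R (tri a b c) = (\int[leb2 R]_(x in tri a b c) 1%:E)%E.
  by rewrite integral_cst// mul1e.
transitivity (\int[leb2 R]_(x in tri a b c)
    ((bary a b c x)%:E + ((bary b c a x)%:E + (bary c a b x)%:E)))%E.
  apply: eq_integral => x _; rewrite -!EFinD addrA bary_sum//.
have mb u v w : measurable_fun (tri a b c) (fun x : R2 => (bary u v w x)%:E).
  by apply/measurable_EFinP; exact: measurable_bary.
rewrite ge0_integralD//; last 4 first.
- by move=> x /(triP _ d0)[+ _ _] /=; rewrite lee_fin.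
- exact: mb.
- by move=> x /(triP _ d0)[_ h1 h2]; rewrite -EFinD lee_fin addr_ge0.
- by apply: emeasurable_funD; exact: mb.
rewrite ge0_integralD//; last 4 first.
- by move=> x /(triP _ d0)[_ + _] /=; rewrite lee_fin.
- exact: mb.
- by move=> x /(triP _ d0)[_ _ +] /=; rewrite lee_fin.
- exact: mb.
rewrite integral_baryE// {1}triC integral_baryE// -det3C.
rewrite -triC integral_baryE// det3C.
have h : (0 <= `|det3 a b c|%:E * ref_moment)%E by rewrite mule_ge0// ref_moment_ge0.
rewrite muleCA (_ : 3%:E = (1 + (1 + 1))%:E); last by congr EFin; ring.
rewrite -(det3C a b c); move: (_ * ref_moment)%E h => m m0.
by rewrite !EFinD !ge0_muleDl ?lee_fin ?addr_ge0// !mul1e.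
Qed.

Lemma ref_triE : ref_tri = tri (1, 0) (0, 1) (0, 0).
Proof.
apply/seteqP; split => s.
  move=> [h1 h2 h3]; exists (s.1, s.2, 1 - s.1 - s.2); split => //=; [lra|lra|].
  rewrite [LHS]surjective_pairing [RHS]surjective_pairing !pairE.
  by congr pair; rewrite /=; ring.
move=> [[[l1 l2] l3] /= [h1 h2 h3 h ->]].
by split; rewrite !pairE /=; lra.
Qed.

(** The reference triangle lies between the squares of side 1/2 and 1 at the origin, so its measure,
    three times the moment, is positive and finite. *)
Lemma ref_moment_fin_pos : exists2 m : R, 0 < m & ref_moment = m%:E.
Proof.
have d1 : det3 ((1, 0) : R * R) (0, 1) (0, 0) = 1.
  by rewrite /det3 /cross !pairE /=; ring.
have d0 : det3 ((1, 0) : R * R) (0, 1) (0, 0) != 0 by rewrite d1 oner_eq0.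
have := leb2_triE d0; rewrite -ref_triE d1 normr1 mul1e => h.
have mt : measurable ref_tri by rewrite ref_triE; exact: measurable_tri.
have I2 (k : R) : 0 <= k -> leb2 R (`[0, k]%classic `*` `[0, k]%classic) = (k ^+ 2)%:E.
  move=> k0; rewrite product_measure1E//= lebesgue_measure_itv /= lte_fin.
  case: ltP => [_|k1]; first by rewrite -EFinB -EFinM subr0 expr2.
  by rewrite (_ : k = 0) ?expr2 ?mul0e ?mulr0//; apply/eqP; rewrite eq_le k0 k1.
have up : (leb2 R ref_tri <= 1)%E.
  rewrite -(expr1n R 2) -I2//; apply: le_measure => //; rewrite ?inE//.
    exact: measurableX.
  by move=> s [h1 h2 h3]; split; rewrite /= in_itv/=; apply/andP; split; lra.
have low : ((2^-1 ^+ 2)%:E <= leb2 R ref_tri)%E.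
  rewrite -I2//; apply: le_measure => //; rewrite ?inE//.
    exact: measurableX.
  move=> s [] /=; rewrite !in_itv/= => /andP[h1 h2] /andP[h3 h4].
  by split => //; lra.
have := ref_moment_ge0; move: h; case: ref_moment => [m|//|//].
  move=> h _; exists m => //; move: low; rewrite h -EFinM lee_fin => low.
  have : (0 : R) < 2^-1 ^+ 2 by rewrite exprn_gt0.
  by lra.
by rewrite gt0_muley ?lte_fin// => h _; rewrite h in up.
Qed.

Lemma area_tri_gt0 a b c : det3 a b c != 0 -> 0 < area (tri a b c).
Proof.
move=> d0; rewrite /area leb2_triE//; have [m m0 ->] := ref_moment_fin_pos.
by rewrite -!EFinM /= mulr_gt0 ?normr_gt0// mulr_gt0.
Qed.

Lemma leb2_tri a b c : det3 a b c != 0 ->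
  leb2 R (tri a b c) = (area (tri a b c))%:E.
Proof.
move=> d0; rewrite /area leb2_triE//; have [m m0 ->] := ref_moment_fin_pos.
by rewrite -!EFinM.
Qed.

Lemma area_tri_ratio a b c a' b' c' : det3 a b c != 0 -> det3 a' b' c' != 0 ->
  area (tri a b c) * `|det3 a' b' c'| = area (tri a' b' c') * `|det3 a b c|.
Proof.
move=> d0 d0'; rewrite /area !leb2_triE//; have [m m0 ->] := ref_moment_fin_pos.
by rewrite -!EFinM /=; ring.
Qed.

Lemma Rintegral_bary a b c : det3 a b c != 0 ->
  \int[leb2 R]_(x in tri a b c) bary a b c x = area (tri a b c) / 3.
Proof.
move=> d0; rewrite /area /Rintegral leb2_triE// integral_baryE//.
have [m m0 ->] := ref_moment_fin_pos.
by rewrite -!EFinM /=; field.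
Qed.
End triangle_integral.

(** * Angles and gradients in the metric of a matrix *)

Section linear_algebra.
Context {R : realType}.
Implicit Types (p q x y z : R * R) (M : 'M[R]_2) (v w : 'cV[R]_2).

Lemma sum_ord2 (V : nmodType) (F : 'I_2 -> V) : \sum_i F i = F 0 + F 1.
Proof. by rewrite big_ord_recl big_ord1; congr (_ + F _); apply/val_inj. Qed.

Lemma bilinE M v w : bilin M v w =
  M 0 0 * v 0 0 * w 0 0 + M 0 1 * v 0 0 * w 1 0 +
  M 1 0 * v 1 0 * w 0 0 + M 1 1 * v 1 0 * w 1 0.
Proof.
by rewrite /bilin !mxE sum_ord2 !mxE !sum_ord2 !mxE; ring.
Qed.

Lemma colv0 x : colv x 0 0 = x.1. Proof. by rewrite mxE. Qed.
Lemma colv1 x : colv x 1 0 = x.2. Proof. by rewrite mxE. Qed.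

Lemma colvK v : colv (v 0 0, v 1 0) = v.
Proof.
apply/matrixP => i j; rewrite (ord1 j) mxE /=.
case: i => -[|[|//]] h; [congr (v _ _)|congr (v _ _)]; exact/val_inj.
Qed.

Lemma colv_eq0 x : (colv x == 0) = (x == 0).
Proof.
apply/eqP/eqP => [h|->]; last by apply/matrixP => i j; rewrite !mxE; case: ifP.
have := congr1 (fun v : 'cV[R]_2 => v 0 0) h; rewrite colv0 mxE => h1.
have := congr1 (fun v : 'cV[R]_2 => v 1 0) h; rewrite colv1 mxE => h2.
by rewrite [x]surjective_pairing h1 h2.
Qed.

Lemma dotE v x : (v^T *m colv x) 0 0 = v 0 0 * x.1 + v 1 0 * x.2.
Proof. by rewrite !mxE sum_ord2 !mxE. Qed.

Lemma det2E M : \det M = M 0 0 * M 1 1 - M 0 1 * M 1 0.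
Proof.
rewrite (expand_det_row _ 0) sum_ord2 /cofactor !det_mx11 !mxE /=.
have -> : lift (0 : 'I_2) 0 = 1 by apply/val_inj.
have -> : lift (1 : 'I_2) 0 = 0 by apply/val_inj.
by rewrite expr0 expr1; ring.
Qed.

Lemma spd_sym M : spd M -> M 1 0 = M 0 1.
Proof. by move=> [h _]; rewrite -[in LHS]h mxE. Qed.

Lemma spd_diag_gt0 M : spd M -> 0 < M 0 0.
Proof.
move=> [_ /(_ (colv (1, 0)))]; rewrite colv_eq0 -pair_eqE /pair_eq/= oner_eq0.
by move=> /(_ isT); rewrite bilinE !(colv0, colv1)/= !(mulr0, mul0r, addr0, mulr1).
Qed.

Lemma spd_det_gt0 M : spd M -> 0 < \det M.
Proof.
move=> h; have a0 := spd_diag_gt0 h; have s := spd_sym h.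
(* On this vector the quadratic form takes the value [M 0 0 * \det M]. *)
have [_ /(_ (colv (- M 0 1, M 0 0)))] := h.
rewrite colv_eq0 -pair_eqE /pair_eq/= negb_and (gt_eqF a0) orbT => /(_ isT).
rewrite bilinE !(colv0, colv1)/= s det2E s.
rewrite (_ : _ + _ = M 0 0 * (M 0 0 * M 1 1 - M 0 1 * M 0 1)); last by ring.
by rewrite pmulr_rgt0.
Qed.

Lemma invmx2E M : \det M != 0 ->
  [/\ invmx M 0 0 = M 1 1 / \det M, invmx M 0 1 = - M 0 1 / \det M,
      invmx M 1 0 = - M 1 0 / \det M & invmx M 1 1 = M 0 0 / \det M].
Proof.
move=> d0; have u : M \in unitmx by rewrite unitmxE unitfE.
have l00 : lift (0 : 'I_2) 0 = 1 by apply/val_inj.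
have l10 : lift (1 : 'I_2) 0 = 0 by apply/val_inj.
rewrite /invmx u; split; rewrite !mxE /cofactor !det_mx11 !mxE /= ?l00 ?l10
 ?expr0 ?expr1 ?expr2 mulrC; congr (_ / _); ring.
Qed.

Lemma bilin_invmx M p q : \det M != 0 ->
  bilin (invmx M) (colv p) (colv q) =
  (M 1 1 * p.1 * q.1 - M 0 1 * p.1 * q.2 - M 1 0 * p.2 * q.1 + M 0 0 * p.2 * q.2)
   / \det M.
Proof.
move=> d0; rewrite bilinE; have [-> -> -> ->] := invmx2E d0.
by rewrite !(colv0, colv1); field.
Qed.

(** Lagrange's identity in the inner product of the inverse of [M]. It yields both strict
    Cauchy-Schwarz and the sine of the angle. *)
Lemma gram_invmx M p q : spd M ->
  bilin (invmx M) (colv p) (colv p) * bilin (invmx M) (colv q) (colv q)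
  - bilin (invmx M) (colv p) (colv q) ^+ 2 = cross p q ^+ 2 / \det M.
Proof.
move=> h; have d0 := lt0r_neq0 (spd_det_gt0 h).
rewrite !bilin_invmx// (spd_sym h).
have := d0; rewrite det2E (spd_sym h) => d1.
by rewrite /cross; field.
Qed.

Lemma bilin_invmx_gt0 M p : spd M -> p != 0 ->
  0 < bilin (invmx M) (colv p) (colv p).
Proof.
move=> h p0; have d0 := spd_det_gt0 h.
rewrite bilin_invmx ?gt_eqF// divr_gt0// (spd_sym h).
(* In dimension two, [\det M] times the inverse of [M] is [M] conjugated by a quarter turn, so [M]
   is tested on the rotated vector. *)
have [_ /(_ (colv (- p.2, p.1)))] := h.
rewrite colv_eq0 -pair_eqE /pair_eq/= oppr_eq0 negb_and orbC.
move: p0; rewrite [p in p != _]surjective_pairing -pair_eqE /pair_eq/= negb_and => ->.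
move=> /(_ isT); rewrite bilinE !(colv0, colv1)/= (spd_sym h).
by congr (0 < _); ring.
Qed.

(** Independence of [p] and [q] puts the argument of [acos] strictly between -1 and 1, so the angle
    is not degenerate; the Gram identity then gives its sine. *)
Lemma cot_angle M x y z (p := x - z) (q := y - z) : spd M -> cross p q != 0 ->
  (0 < angle (invmx M) x y z < pi) /\
  cot (angle (invmx M) x y z) =
    bilin (invmx M) (colv p) (colv q) * Num.sqrt (\det M) / `|cross p q|.
Proof.
move=> h c0; have d0 := spd_det_gt0 h.
have p0 : p != 0.
  by apply: contraNneq c0 => ->; rewrite /cross /= !mul0r subrr.
have q0 : q != 0.
  by apply: contraNneq c0 => ->; rewrite /cross /= !mulr0 subrr.
have pp := bilin_invmx_gt0 h p0; have qq := bilin_invmx_gt0 h q0.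
rewrite /angle -/p -/q.
have := gram_invmx p q h.
set A := bilin _ (colv p) (colv p) in pp *.
set B := bilin _ (colv q) (colv q) in qq *.
set C := bilin _ (colv p) (colv q) => hAB.
have AB0 : 0 < Num.sqrt A * Num.sqrt B by rewrite mulr_gt0// sqrtr_gt0.
have AB2 : (Num.sqrt A * Num.sqrt B) ^+ 2 = A * B.
  by rewrite exprMn !sqr_sqrtr// ltW.
have g0 : 0 < cross p q ^+ 2 / \det M by rewrite divr_gt0// exprn_even_gt0.
have t1 : C / (Num.sqrt A * Num.sqrt B) < 1.
  rewrite ltr_pdivrMr// mul1r; apply: le_lt_trans (ler_norm _) _.
  by rewrite -(@ltr_pXn2r _ 2)// ?nnegrE// ?ltW// real_normK ?num_real// AB2; lra.
have t2 : -1 < C / (Num.sqrt A * Num.sqrt B).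
  rewrite ltr_pdivlMr// mulN1r ltrNl; apply: le_lt_trans (ler_norm _) _.
  by rewrite -(@ltr_pXn2r _ 2)// ?nnegrE// ?ltW// real_normK ?num_real// sqrrN AB2; lra.
set t := C / _ in t1 t2 *.
split; first by rewrite acos_gt0 ?acos_ltpi ?t1 ?t2 ?ltW.
rewrite /cot acosK ?in_itv/= ?ltW// sin_acos ?ltW//.
have -> : 1 - t ^+ 2 = (cross p q / (Num.sqrt (\det M) * (Num.sqrt A * Num.sqrt B))) ^+ 2.
  rewrite [in RHS]expr_div_n [in RHS]exprMn AB2 sqr_sqrtr ?(ltW d0)//.
  rewrite /t expr_div_n AB2.
  have AB0' : A * B != 0 by rewrite mulf_neq0// gt_eqF.
  rewrite [in RHS]invfM [in RHS]mulrA -hAB; field.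
  by move: AB0'; rewrite mulf_eq0 negb_or andbC.
rewrite sqrtr_sqr normrM normfV (gtr0_norm (_ : 0 < Num.sqrt (\det M) * _)); last first.
  by rewrite mulr_gt0// sqrtr_gt0.
rewrite /t; field.
by rewrite !gt_eqF// ?normr_gt0// ?sqrtr_gt0.
Qed.
End linear_algebra.

(** * Cotangents, the largest eigenvalue, and gradients of barycentric coordinates *)

Section angles_and_gradients.
Context {R : realType}.
Implicit Types (p q x y z : R * R) (M : 'M[R]_2) (v w : 'cV[R]_2).

(** Since [arccot] is a choice, a witness is required: the angle with cosine [s / sqrt(1 + s^2)],
    whose sine is [1 / sqrt(1 + s^2)]. *)
Lemma arccotP (s : R) : 0 < arccot s < pi /\ cot (arccot s) = s.
Proof.
apply: (@getPex _ [set t : R | 0 < t < pi /\ cot t = s]).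
have h0 : 0 < 1 + s ^+ 2 by rewrite ltr_pwDl// sqr_ge0.
have r0 : 0 < Num.sqrt (1 + s ^+ 2) by rewrite sqrtr_gt0.
have sr : `|s| < Num.sqrt (1 + s ^+ 2).
  by rewrite -sqrtr_sqr ltr_sqrt// ltrDr.
pose t := s / Num.sqrt (1 + s ^+ 2).
have t1 : t < 1.
  by rewrite ltr_pdivrMr// mul1r (le_lt_trans (ler_norm _)).
have t2 : -1 < t.
  by rewrite ltr_pdivlMr// mulN1r ltrNl (le_lt_trans (ler_norm _))// normrN.
exists (acos t); split; first by rewrite acos_gt0 ?acos_ltpi ?t1 ?t2 ?ltW.
rewrite /cot acosK ?in_itv/= ?ltW// sin_acos ?ltW//.
have -> : 1 - t ^+ 2 = (Num.sqrt (1 + s ^+ 2))^-1 ^+ 2.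
  rewrite /t expr_div_n exprVn sqr_sqrtr ?ltW//; field; exact: lt0r_neq0.
rewrite sqrtr_sqr ger0_norm ?invr_ge0 ?ltW// /t invrK divfK//.
exact: lt0r_neq0.
Qed.

(** Because [sin (s + t) = sin s * sin t * (cot s + cot t)], and the sine is nonnegative on
    [[0, pi]]. *)
Lemma cot_add_lt0 (s t : R) : 0 < s < pi -> 0 < t < pi ->
  cot s + cot t < 0 -> pi < s + t.
Proof.
move=> s0 t0 h; have ss := sin_gt0_pi s0; have st := sin_gt0_pi t0.
rewrite ltNge; apply/negP => le_pi.
have : 0 <= sin (s + t).
  move: s0 t0 => /andP[s0 _] /andP[t0 _].
  by apply: sin_ge0_pi; rewrite le_pi addr_ge0// ltW.
have -> : sin (s + t) = sin s * sin t * (cot s + cot t).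
  by rewrite sinD /cot; field; rewrite !gt_eqF.
by rewrite leNgt pmulr_rlt0 ?mulr_gt0// h.
Qed.

(* If the two weighted cotangents had a negative sum, each of the two pairs
   (an angle, the arccotangent attached to the other angle) would exceed [pi]. *)
Lemma delaunay_cot (al al' d d' : R) : 0 < al < pi -> 0 < al' < pi ->
  0 < d -> 0 < d' ->
  1 / 2 * (al + arccot (Num.sqrt (d / d') * cot al)
           + al' + arccot (Num.sqrt (d' / d) * cot al')) <= pi ->
  0 <= Num.sqrt d * cot al + Num.sqrt d' * cot al'.
Proof.
move=> ha ha' d0 d0' h; rewrite leNgt; apply/negP => neg.
have [b1 b2] := arccotP (Num.sqrt (d / d') * cot al).
have [c1 c2] := arccotP (Num.sqrt (d' / d) * cot al').
have s0 : 0 < Num.sqrt d by rewrite sqrtr_gt0.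
have s0' : 0 < Num.sqrt d' by rewrite sqrtr_gt0.
have h1 : pi < al + arccot (Num.sqrt (d' / d) * cot al').
  apply: cot_add_lt0 => //; rewrite c2 sqrtrM ?ltW// sqrtrV ?ltW//.
  rewrite -(pmulr_rlt0 _ s0); move: neg; congr (_ < 0).
  by field; rewrite gt_eqF.
have h2 : pi < arccot (Num.sqrt (d / d') * cot al) + al'.
  apply: cot_add_lt0 => //; rewrite b2 sqrtrM ?ltW// sqrtrV ?ltW//.
  rewrite -(pmulr_rlt0 _ s0'); move: neg; congr (_ < 0).
  by field; rewrite gt_eqF.
lra.
Qed.

Lemma lambda_max_ge M v : spd M ->
  bilin M v v <= lambda_max M * (v 0 0 ^+ 2 + v 1 0 ^+ 2).
Proof.
move=> h; have s := spd_sym h.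
set a := M 0 0; set c := M 1 1; set b := M 0 1.
pose r := Num.sqrt ((a - c) ^+ 2 + 4 * b ^+ 2).
have r2 : r ^+ 2 = (a - c) ^+ 2 + 4 * b ^+ 2.
  by rewrite sqr_sqrtr// addr_ge0 ?sqr_ge0// mulr_ge0// sqr_ge0.
have r0 : 0 <= r by exact: sqrtr_ge0.
(* The larger root of the characteristic polynomial. With [l - a] and [l - c] nonnegative and of
   product [b ^+ 2], the matrix [l I - M] is positive semidefinite. *)
pose l := (a + c + r) / 2.
have la : 0 <= l - a.
  have : a - c <= r.
    rewrite (le_trans (ler_norm _))// -(@ler_pXn2r _ 2)// ?nnegrE// real_normK ?num_real// r2.
    by rewrite lerDl mulr_ge0// sqr_ge0.
  by rewrite /l; lra.
have lc : 0 <= l - c.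
  have : c - a <= r.
    rewrite (le_trans (ler_norm _))// -(@ler_pXn2r _ 2)// ?nnegrE// real_normK ?num_real// r2.
    by rewrite -sqrrN opprB lerDl mulr_ge0// sqr_ge0.
  by rewrite /l; lra.
have lac : (l - a) * (l - c) = b ^+ 2.
  rewrite (_ : _ * _ = (r ^+ 2 - (a - c) ^+ 2) / 4); last by rewrite /l; field.
  by rewrite r2; field.
have Rayleigh w : bilin M w w <= l * (w 0 0 ^+ 2 + w 1 0 ^+ 2).
  rewrite bilinE s -/a -/b -/c -subr_ge0.
  set x := w 0 0; set y := w 1 0.
  have [a0|a0] := eqVneq (l - a) 0.
    have b0 : b = 0 by apply/eqP; rewrite -sqrf_eq0 -lac a0 mul0r.
    have : 0 <= (l - a) * x ^+ 2 + (l - c) * y ^+ 2.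
      by rewrite addr_ge0// mulr_ge0// sqr_ge0.
    by congr (0 <= _); rewrite b0; ring.
  have a1 : 0 < l - a by rewrite lt_neqAle eq_sym a0.
  (* Multiplying by [l - a] completes the square: the form becomes [((l - a) x - b y)^2]. *)
  rewrite -(pmulr_rge0 _ a1).
  have : 0 <= ((l - a) * x - b * y) ^+ 2 + ((l - a) * (l - c) - b ^+ 2) * y ^+ 2.
    by rewrite lac subrr mul0r addr0 sqr_ge0.
  by congr (0 <= _); ring.
have eigl : eigenvalue M l.
  have [w w0 hw] : exists2 w : 'rV[R]_2, w != 0 & w *m M = l *: w.
    have eqw (x y : R) : (l - a) * x = b * y -> (l - c) * y = b * x ->
        (\row_j (if j == 0 then x else y)) *m M = l *: (\row_j (if j == 0 then x else y)).
      move=> h1 h2; apply/rowP => j; rewrite !mxE sum_ord2 !mxE /=.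
      have [->|->] : j = 0 \/ j = 1.
        by case: j => -[|[|//]] hj; [left|right]; exact/val_inj.
        by rewrite /= s -/a -/b; lra.
      by rewrite /= -/b -/c; lra.
    have [b0|b0] := eqVneq b 0.
      have [a0|a0] := eqVneq (l - a) 0.
        exists (\row_j (if j == 0 then 1 else 0)); last by apply: eqw; rewrite ?a0 ?b0; ring.
        by apply/eqP => /rowP/(_ 0); rewrite !mxE /= => /eqP; rewrite oner_eq0.
      have c0 : l - c = 0.
        by apply/eqP; move/eqP: lac; rewrite b0 expr0n/= mulf_eq0 (negbTE a0).
      exists (\row_j (if j == 0 then 0 else 1)); last by apply: eqw; rewrite ?c0 ?b0; ring.
      by apply/eqP => /rowP/(_ 1); rewrite !mxE /= => /eqP; rewrite oner_eq0.
    exists (\row_j (if j == 0 then b else l - a)); last first.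
      by apply: eqw; [ring|rewrite mulrC lac expr2].
    by apply/eqP => /rowP/(_ 0); rewrite !mxE /= => /eqP; rewrite (negbTE b0).
  by apply/eigenvalueP; exists w.
(* [lambda_max] is a [sup], so the set of eigenvalues must be bounded before [l] can be compared
   with it; the Rayleigh bound at an eigenvector does this. *)
have ub : ubound [set k : R | eigenvalue M k] l.
  move=> k /= /eigenvalueP[w hw w0].
  have n0 : 0 < w 0 0 ^+ 2 + w 0 1 ^+ 2.
    rewrite lt_neqAle eq_sym addr_ge0 ?sqr_ge0// andbT.
    apply: contra w0; rewrite paddr_eq0 ?sqr_ge0// !sqrf_eq0 => /andP[/eqP w00 /eqP w01].
    apply/eqP/rowP => j; rewrite mxE.
    by case: j => -[|[|//]] hj; [rewrite -[RHS]w00|rewrite -[RHS]w01]; congr (w _ _); exact/val_inj.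
  have := Rayleigh w^T; rewrite /bilin trmxK hw -scalemxAl mxE.
  have -> : (w *m w^T) 0 0 = w 0 0 ^+ 2 + w 0 1 ^+ 2.
    by rewrite mxE sum_ord2 !mxE !expr2.
  by rewrite !mxE ler_pM2r.
have le_l : l <= lambda_max M by apply: ub_le_sup => //; exists l.
apply: le_trans (Rayleigh v) _; rewrite ler_wpM2r//.
by rewrite addr_ge0// sqr_ge0.
Qed.

(** The gradient of [bary x y z]: a quarter turn of the edge opposite to [x], divided by the signed
    double area. *)
Definition gvec x y z : 'cV[R]_2 :=
  colv ((y.2 - z.2) / det3 x y z, (z.1 - y.1) / det3 x y z).

Lemma gvec_sum x y z : det3 x y z != 0 ->
  gvec x y z + gvec y z x + gvec z x y = 0.
Proof.
move=> d0; apply/colP => i; rewrite !mxE -(det3C x y z) (det3C z x y).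
by case: ifP => _ /=; field.
Qed.

Lemma has_grad_diff A F v x y : has_grad A F v -> A x -> A y ->
  F x - F y = v 0 0 * (x.1 - y.1) + v 1 0 * (x.2 - y.2).
Proof. by move=> [k h] Ax Ay; rewrite !h// !dotE; ring. Qed.

(** The differences of [F] along two independent edges determine [v], so the gradient is read off
    from the three vertex values. *)
Lemma has_gradE A F v x y z : det3 x y z != 0 -> A x -> A y -> A z ->
  has_grad A F v ->
  v = F x *: gvec x y z + F y *: gvec y z x + F z *: gvec z x y.
Proof.
move=> d0 Ax Ay Az h.
have h1 := has_grad_diff h Ax Az; have h2 := has_grad_diff h Ay Az.
rewrite -[v in LHS]colvK; apply/colP => i; rewrite !mxE -(det3C x y z) (det3C z x y).
have -> : F x = F z + (F x - F z) by ring.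
have -> : F y = F z + (F y - F z) by ring.
rewrite h1 h2; move: d0; rewrite /det3 /cross !pairE => d0.
by case: ifP => _ /=; field.
Qed.

(** A quarter turn replaces [M] by [\det M] times its inverse, so this is the inverse-metric product
    of two edges meeting at [z]; the minus sign comes from their cyclic orientation. *)
Lemma bilin_gvec M x y z : spd M -> det3 x y z != 0 ->
  bilin M (gvec x y z) (gvec y z x) =
  - (Num.sqrt (\det M) * cot (angle (invmx M) x y z)) / `|det3 x y z|.
Proof.
move=> h d0.
have cE : cross (x - z) (y - z) = det3 x y z by rewrite -[LHS]/(det3 z x y) det3C.
have c0 : cross (x - z) (y - z) != 0 by rewrite cE.
have [_ ->] := cot_angle h c0; rewrite cE.
have m0 := spd_det_gt0 h.
have -> : - (Num.sqrt (\det M) * (bilin (invmx M) (colv (x - z)) (colv (y - z)) *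
      Num.sqrt (\det M) / `|det3 x y z|)) / `|det3 x y z|
    = - (Num.sqrt (\det M)) ^+ 2 * bilin (invmx M) (colv (x - z)) (colv (y - z)) / `|det3 x y z| ^+ 2.
  by field; rewrite normr_eq0.
rewrite sqr_sqrtr ?ltW// real_normK ?num_real// bilin_invmx ?gt_eqF//.
rewrite bilinE /gvec !(colv0, colv1) (spd_sym h) -(det3C x y z) !pairE /=.
by field; rewrite d0 gt_eqF.
Qed.
End angles_and_gradients.

(** * Triangles around an interior edge *)

Section hulls.
Context {R : realType} {I : finType}.
Implicit Types (a : I -> R * R) (S : {set I}).

Lemma sum_support3 (V : nmodType) (F : I -> V) i j k : uniq [:: i; j; k] ->
  (forall m, m \notin [set i; j; k]%SET -> F m = 0) ->
  \sum_m F m = F i + F j + F k.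
Proof.
move=> /= /andP[]; rewrite !inE negb_or => /andP[ij ik] /andP[jk _] F0.
rewrite (bigD1 i)//= (bigD1 j)//=; last by rewrite eq_sym.
rewrite (bigD1 k)//=; last by rewrite ![k == _]eq_sym ik jk.
rewrite big1 ?addr0 ?addrA// => m /andP[/andP[mi mj] mk].
by apply: F0; rewrite !inE (negbTE mi) (negbTE mj) (negbTE mk).
Qed.

Lemma hull3 a i j k : uniq [:: i; j; k] ->
  hull a [set i; j; k]%SET = tri (a i) (a j) (a k).
Proof.
move=> u; have /= := u; rewrite !inE negb_or andbT => /andP[/andP[ij ik] jk].
apply/seteqP; split => x.
  move=> [l [l0 l1 ls ->]]; exists (l i, l j, l k); split => //=.
    by rewrite -ls (sum_support3 u).
  by rewrite (sum_support3 u)// => m /l0 ->; rewrite scale0r.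
move=> [[[l1 l2] l3] /= [h1 h2 h3 h ->]].
pose l m := if m == i then l1 else if m == j then l2 else if m == k then l3 else 0.
have li : l i = l1 by rewrite /l eqxx.
have lj : l j = l2 by rewrite /l eqxx eq_sym (negbTE ij).
have lk : l k = l3 by rewrite /l eqxx ![k == _]eq_sym (negbTE ik) (negbTE jk).
have l0 m : m \notin [set i; j; k]%SET -> l m = 0.
  by rewrite !inE !negb_or /l => /andP[/andP[/negbTE -> /negbTE ->] /negbTE ->].
exists l; split => //.
- by move=> m; rewrite /l; do 3 case: ifP => // _.
- by rewrite (sum_support3 u)// li lj lk.
- by rewrite (sum_support3 u) ?li ?lj ?lk// => m /l0 ->; rewrite scale0r.
Qed.

(** [det3 (a i) (a j)] is affine in its last argument and vanishes at both [a i] and [a j]. *)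
Lemma hull2_det3 a S i j x : S \subset [set i; j]%SET -> hull a S x ->
  det3 (a i) (a j) x = 0.
Proof.
move=> /fintype.subsetP sS [l [l0 _ l1 ->]].
have F m : l m * det3 (a i) (a j) (a m) = 0.
  have [|mS] := boolP (m \in S); last by rewrite l0// mul0r.
  move/sS; rewrite !inE => /orP[] /eqP ->; rewrite /det3 /cross !pairE; ring.
have E : det3 (a i) (a j) (\sum_m l m *: a m) = \sum_m l m * det3 (a i) (a j) (a m).
  have f1 : (\sum_m l m *: a m).1 = \sum_m l m * (a m).1.
    by elim/big_rec2: _ => // m y1 y2 _ <-.
  have f2 : (\sum_m l m *: a m).2 = \sum_m l m * (a m).2.
    by elim/big_rec2: _ => // m y1 y2 _ <-.
  transitivity (\sum_m l m * (((a j).1 - (a i).1) * (a m).2 - ((a j).2 - (a i).2) * (a m).1)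
      - (\sum_m l m) * cross (a j - a i) (a i)).
    under [X in _ = X - _]eq_bigr do rewrite mulrBr mulrCA [X in _ - X]mulrCA.
    by rewrite sumrB -!mulr_sumr -f1 -f2 l1 /det3 /cross !pairE; ring.
  rewrite mulr_suml -sumrB; apply: eq_bigr => m _.
  by rewrite /det3 /cross !pairE; ring.
by rewrite E big1.
Qed.

Lemma hull_vertex a S i : i \in S -> hull a S (a i).
Proof.
move=> iS; exists (fun m => (m == i)%:R); split.
- by move=> m; case: eqVneq => // ->; rewrite iS.
- by move=> m; rewrite ler0n.
- by rewrite (bigD1 i)//= eqxx big1 ?addr0// => m /negbTE ->.
- rewrite (bigD1 i)//= eqxx scale1r big1 ?addr0// => m /negbTE ->.
  by rewrite scale0r.
Qed.

End hulls.

Section edges.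
Context {R : realType} {Om : set (R * R)} {ni nb : nat}.
Variable Th : triangulation Om ni nb.
Local Notation nv := (ni + nb)%N.
Local Notation a := (vtx Th).
Implicit Types (K : {set 'I_nv}) (i j k : 'I_nv).

Lemma card3_uniq i j k : #|[set i; j; k]%SET| = 3%N -> uniq [:: i; j; k].
Proof.
rewrite finset.setUC cardsU1 cards2 !inE /= !inE andbT negb_or.
rewrite ![k == _]eq_sym.
by case: (i == j); case: (i == k); case: (j == k).
Qed.

Lemma elt_uniq i j k : [set i; j; k]%SET \in elts Th -> uniq [:: i; j; k].
Proof. by move/elts_card/card3_uniq. Qed.

Lemma elt_det3 i j k : [set i; j; k]%SET \in elts Th ->
  det3 (a i) (a j) (a k) != 0.
Proof. exact: elts_nondegenerate. Qed.

Lemma elt_tri i j k : [set i; j; k]%SET \in elts Th ->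
  elt Th [set i; j; k]%SET = tri (a i) (a j) (a k).
Proof. by move/elt_uniq; exact: hull3. Qed.

Lemma elt_vertexP K i : K \in elts Th -> i \in K ->
  exists j k, K = [set i; j; k]%SET.
Proof.
move=> /elts_card K3 iK.
have /cards2P[j [k [jk E]]] : #|K :\ i| == 2%N.
  by have := cardsD1 i K; rewrite iK K3 add1n => -[] <-.
exists j, k; rewrite -(finset.setD1K iK) E.
by apply/finset.setP => m; rewrite !inE orbA.
Qed.

Lemma elt_edgeP K i j : K \in elts Th -> i \in K -> j \in K -> i != j ->
  exists k, K = [set i; j; k]%SET.
Proof.
move=> KT iK jK ij; have [j' [k E]] := elt_vertexP KT iK.
move: jK; rewrite E !inE eq_sym (negbTE ij)/= => /orP[/eqP ->|/eqP ->]; first by exists k.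
by exists j'; apply/finset.setP => m; rewrite !inE orbAC.
Qed.

Lemma eltP K : K \in elts Th -> exists i j k, K = [set i; j; k]%SET.
Proof.
move=> KT; have [i iK] : exists i, i \in K.
  by apply/finset.set0Pn; rewrite -card_gt0 (elts_card KT).
by have [j [k ->]] := elt_vertexP KT iK; exists i, j, k.
Qed.

(* Two triangles on the same side of the edge would overlap in a point off the
   line of the edge, against conformity. *)
Lemma elts_opposite_sides i j k k' :
  [set i; j; k]%SET \in elts Th -> [set i; j; k']%SET \in elts Th -> k != k' ->
  det3 (a i) (a j) (a k) * det3 (a i) (a j) (a k') < 0.
Proof.
move=> KT KT' kk'; rewrite ltNge; apply/negP => ge0.
have d := elt_det3 KT; have d' := elt_det3 KT'.
have u := elt_uniq KT; have u' := elt_uniq KT'.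
set b1 := bary (a i) (a j) (a k') (a k).
set b2 := bary (a j) (a k') (a i) (a k).
set b3 := bary (a k') (a i) (a j) (a k).
have bs : b1 + b2 + b3 = 1 by exact: bary_sum.
have b3_gt0 : 0 < b3.
  rewrite /b3 /bary !(det3C _ (a i) (a j)) lt_neqAle eq_sym.
  rewrite mulf_neq0 ?invr_eq0//= -(pmulr_lge0 _ (_ : 0 < det3 (a i) (a j) (a k') ^+ 2)).
    by rewrite expr2 mulrA divfK.
  by rewrite exprn_even_gt0.
(* The test point is the midpoint of the edge moved by [s] times [a k - a i]. This [s] makes
   [s (1 + |b1| + |b2|)] equal to 1/2, which keeps its coordinates nonnegative in both triangles. *)
pose s := (2 * (1 + `|b1| + `|b2|))^-1.
have n0 : 0 < 1 + `|b1| + `|b2| by rewrite ltr_pwDl// ?ltr_pwDl.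
have s0 : 0 < s by rewrite invr_gt0 mulr_gt0.
have s1 : s * (1 + `|b1| + `|b2|) = 2^-1.
  by rewrite /s; field; rewrite gt_eqF.
have s2 : s + s * `|b1| + s * `|b2| = 2^-1 by rewrite -s1; ring.
have sb1 : 0 <= s * `|b1| by rewrite mulr_ge0// ltW.
have sb2 : 0 <= s * `|b2| by rewrite mulr_ge0// ltW.
have sb1' : - (s * `|b1|) <= s * b1 by rewrite -mulrN ler_pM2l// lerNl -normrN ler_norm.
have sb2' : - (s * `|b2|) <= s * b2 by rewrite -mulrN ler_pM2l// lerNl -normrN ler_norm.
pose x := (2^-1 - s) *: a i + 2^-1 *: a j + s *: a k.
have xK : hull a [set i; j; k]%SET x.
  by rewrite hull3//; exists (2^-1 - s, 2^-1, s); split => //=; lra.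
have xK' : hull a [set i; j; k']%SET x.
  rewrite hull3//; exists (2^-1 - s + s * b1, 2^-1 + s * b2, s * b3).
  split => //=; [lra|lra|by rewrite mulr_ge0// ltW| |].
    by rewrite (_ : b3 = 1 - b1 - b2); [field|lra].
  rewrite /x [in LHS](bary_combo (a k) d') -/b1 -/b2 -/b3.
  rewrite [LHS]surjective_pairing [RHS]surjective_pairing !pairE.
  by congr pair; ring.
have : (hull a [set i; j; k]%SET `&` hull a [set i; j; k']%SET) x by [].
rewrite elts_conforming// => /hull2_det3 => /(_ i j) h.
have : det3 (a i) (a j) x = 0.
  apply: h; apply/fintype.subsetP => m; rewrite !inE.
  by case: eqVneq => // _; case: eqVneq => // _ /= /andP[/eqP ->]; rewrite (negbTE kk').
have -> : det3 (a i) (a j) x = s * det3 (a i) (a j) (a k).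
  by rewrite /x /det3 /cross !pairE; field.
by move/eqP; rewrite mulf_eq0 (negbTE d) orbF gt_eqF.
Qed.

End edges.

Section interior_edges.
Context {R : realType} {Om : set (R * R)} {ni nb : nat}.
Hypothesis Om_open : open Om.
Variable Th : triangulation Om ni nb.
Local Notation nv := (ni + nb)%N.
Local Notation a := (vtx Th).
Implicit Types (K : {set 'I_nv}) (i j k : 'I_nv).

Lemma near0_affine_lt0 (b c : R) : b < 0 -> \forall s \near (0 : R)^'+, b - s * c < 0.
Proof.
move=> b0; have e0 : 0 < - b / (1 + `|c|).
  by rewrite divr_gt0 ?oppr_gt0// ltr_pwDl.
near=> s.
have s0 : 0 < s by near: s; exact: nbhs_right_gt.
have : s < - b / (1 + `|c|) by near: s; exact: nbhs_right_lt.
rewrite ltr_pdivlMr ?ltr_pwDl// mulrDr mulr1 => h.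
have : s * - c <= s * `|c| by rewrite ler_pM2l// -normrN ler_norm.
by rewrite mulrN; lra.
Unshelve. all: by end_near. Qed.

Lemma near0_open (p w : R * R) : Om p -> \forall s \near (0 : R)^'+, Om (p - s *: w).
Proof.
move=> Omp.
have : (fun s : R => p - s *: w) @ (0 : R)^'+ --> p.
  rewrite -[X in _ --> X]subr0 -(scale0r w); apply: cvgB; first exact: cvg_cst.
  apply: cvgZr_tmp; apply: cvg_at_right_filter; exact: cvg_id.
by apply; exact: open_nbhs_nbhs.
Qed.

Lemma bary_shift x y z (p w : R * R) :
  exists c, forall s, bary x y z (p - s *: w) = bary x y z p - s * c.
Proof.
have H v (r : R) : exists c, forall s, aff v r (p - s *: w) = aff v r p - s * c.
  by exists (v.1 * w.1 + v.2 * w.2) => s; rewrite /aff !pairE; ring.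
by rewrite bary_aff; exact: H.
Qed.

(** A barycentric coordinate that is negative at [p] stays negative a little further along the
    ray. *)
Lemma near0_notin_tri p x y z (w : R * R) : det3 x y z != 0 -> ~ tri x y z p ->
  \forall s \near (0 : R)^'+, ~ tri x y z (p - s *: w).
Proof.
move=> d0 /(triP _ d0) np.
have [c1 E1] := bary_shift x y z p w.
have [c2 E2] := bary_shift y z x p w.
have [c3 E3] := bary_shift z x y p w.
have := np; have [h1 _|h1 _] := ltP (bary x y z p) 0.
  apply: filterS (near0_affine_lt0 c1 h1) => s; rewrite -E1 => h /(triP _ d0)[].
  by rewrite leNgt h.
have := np; have [h2 _|h2 _] := ltP (bary y z x p) 0.
  apply: filterS (near0_affine_lt0 c2 h2) => s; rewrite -E2 => h /(triP _ d0)[_].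
  by rewrite leNgt h.
have [h3|h3] := ltP (bary z x y p) 0.
  apply: filterS (near0_affine_lt0 c3 h3) => s; rewrite -E3 => h /(triP _ d0)[_ _].
  by rewrite leNgt h.
by case: np.
Qed.

(* Push a point of the edge, close to [a i] and hence in [Om], to the side away
   from [a k]: the element that contains the pushed point also contains the
   point of the edge, hence by conformity the whole edge. *)
Lemma second_element i j k : [set i; j; k]%SET \in elts Th -> Om (a i) ->
  exists k', [/\ [set i; j; k']%SET \in elts Th, k != k' &
    forall K, K \in elts Th -> i \in K -> j \in K ->
      K = [set i; j; k]%SET \/ K = [set i; j; k']%SET].
Proof.
move=> KT Omi; have u := elt_uniq KT; have d0 := elt_det3 KT.
have := u; rewrite /= !inE negb_or andbT => /andP[/andP[ij ik] jk].
(* Strict bounds on [t] keep the weights of both endpoints nonzero; these weights later force [i]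
   and [j] into the element that is found. *)
have [t [t0 t1 Omt]] : exists t : R, [/\ 0 < t, t < 1 & Om (a i - t *: (a i - a j))].
  apply: (@filter_ex _ (0 : R)^'+); near=> t; split; near: t.
  - exact: nbhs_right_gt.
  - exact: nbhs_right_lt.
  - exact: near0_open.
set p := a i - t *: (a i - a j) in Omt.
have pE : p = (1 - t) *: a i + t *: a j + 0 *: a k.
  rewrite [LHS]surjective_pairing [RHS]surjective_pairing !pairE.
  by congr pair; ring.
pose w := a k - a i.
(* There are finitely many elements, so one [s] is small enough for all those that miss [p]. By
   contraposition, an element containing the pushed point contains [p]. *)
have [s [s0 Oms sK]] : exists s : R, [/\ 0 < s, Om (p - s *: w) &
    forall K, K \in elts Th -> ~ elt Th K p -> ~ elt Th K (p - s *: w)].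
  apply: (@filter_ex _ (0 : R)^'+); near=> s; split; near: s.
  - exact: nbhs_right_gt.
  - exact: near0_open.
  - apply: filter_forall => K; have [KK|KK] := boolP (K \in elts Th); last first.
      by apply: nearW.
    have [x [y [z KE]]] := eltP KK; rewrite KE in KK *.
    have [Kp|Kp] := pselect (elt Th [set x; y; z]%SET p).
      by apply: nearW => s _ /(_ Kp).
    have := Kp; rewrite elt_tri// => /(near0_notin_tri w (elt_det3 KK)).
    by apply: filterS.
have : closure Om (p - s *: w) by exact: subset_closure.
rewrite (elts_cover Th) => -[K /= KK Ks].
have Kp : elt Th K p by apply: contrapT => /(sK _ KK).
have Kp0 : hull a [set i; j; k]%SET p.
  by rewrite hull3//; exists (1 - t, t, 0); split => //=; lra.
have : (hull a [set i; j; k]%SET `&` hull a K) p by split.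
rewrite elts_conforming// => -[l [l0 _ l1 lp]].
have lS m : m \notin [set i; j; k]%SET -> l m = 0.
  by move=> mS; apply: l0; rewrite inE (negbTE mS).
have l1' : l i + l j + l k = 1 by rewrite -l1 (sum_support3 u).
have lp' : p = l i *: a i + l j *: a j + l k *: a k.
  by rewrite lp (sum_support3 u)// => m /lS ->; rewrite scale0r.
(* Barycentric coordinates in the first triangle are unique, so the weights supplied by conformity,
   supported on common vertices, are those of [p]. *)
have li : l i = 1 - t.
  rewrite -(baryE d0 l1') -lp' pE baryE//; ring.
have lj : l j = t.
  have d1 : det3 (a j) (a k) (a i) != 0 by rewrite -det3C.
  have l2 : l j + l k + l i = 1 by rewrite -l1'; ring.
  have lp2 : p = l j *: a j + l k *: a k + l i *: a i by rewrite addrC addrA.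
  have pE2 : p = t *: a j + 0 *: a k + (1 - t) *: a i by rewrite addrC addrA.
  by rewrite -(baryE d1 l2) -lp2 pE2 baryE//; ring.
have iK : i \in K.
  apply: contraT => iK; have := l0 i; rewrite inE (negbTE iK) andbF => /(_ isT).
  by rewrite li => /eqP; rewrite subr_eq0 gt_eqF.
have jK : j \in K.
  apply: contraT => jK; have := l0 j; rewrite inE (negbTE jK) andbF => /(_ isT).
  by rewrite lj => /eqP; rewrite gt_eqF.
have [k' KE] := elt_edgeP KK iK jK ij; rewrite {}KE in KK Ks Kp iK jK.
(* In the first triangle the pushed point has coordinate [- s] at [a k], so it lies outside. *)
have kk' : k != k'.
  apply/eqP => kE; move: Ks; rewrite -kE hull3// => /(triP _ d0)[_ _].
  have -> : p - s *: w = (1 - t + s) *: a i + t *: a j + (- s) *: a k.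
    rewrite [LHS]surjective_pairing [RHS]surjective_pairing /w pE !pairE.
    by congr pair; ring.
  have d2 : det3 (a k) (a i) (a j) != 0 by rewrite det3C.
  by rewrite addrC addrA baryE//; [lra|ring].
exists k'; split => // K' KK' iK' jK'.
have [k'' KE] := elt_edgeP KK' iK' jK' ij; rewrite {}KE in KK' iK' jK' *.
have [->|kk''] := eqVneq k k''; first by left.
have [->|k'k''] := eqVneq k' k''; first by right.
have h1 := elts_opposite_sides KT KK kk'.
have h2 := elts_opposite_sides KT KK' kk''.
have h3 := elts_opposite_sides KK KK' k'k''.
(* A third element is impossible: [k'] and [k''] both lie opposite to [k], hence on the same side,
   against [h3]. *)
have : 0 < det3 (a i) (a j) (a k) ^+ 2 * (det3 (a i) (a j) (a k') * det3 (a i) (a j) (a k'')).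
  rewrite (_ : _ * _ = (det3 (a i) (a j) (a k) * det3 (a i) (a j) (a k')) *
     (det3 (a i) (a j) (a k) * det3 (a i) (a j) (a k''))); last by ring.
  by rewrite nmulr_rgt0.
by rewrite pmulr_rgt0 ?exprn_even_gt0// ltNge ltW.
Unshelve. all: by end_near. Qed.
End interior_edges.

(** * Integrals outside a null set *)

Section almost_everywhere.
Context d (T : measurableType d) (R : realType) (mu : {measure set T -> \bar R}).
Implicit Types (A N : set T) (f : T -> R).

(** A zero integral would make [f] vanish almost everywhere off [N], so that [A] would be covered by
    two null sets. *)
Lemma ae_gt0_Rintegral A N f : measurable A -> measurable N -> mu N = 0%E ->
  (0 < mu A)%E -> mu.-integrable A (EFin \o f) ->
  (forall x, A x -> ~ N x -> 0 < f x) -> 0 < \int[mu]_(x in A) f x.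
Proof.
move=> mA mN N0 A0 fi fpos.
have mB : measurable (A `\` N) by exact: measurableD.
have fpos' x : (A `\` N) x -> 0 < f x by case; exact: fpos.
have ge0 : (0 <= \int[mu]_(x in A `\` N) (EFin \o f) x)%E.
  by apply: integral_ge0 => x /fpos' /ltW; rewrite lee_fin.
rewrite /Rintegral -/(EFin \o f) (negligible_integral mN mA fi N0).
have fin : (\int[mu]_(x in A `\` N) (EFin \o f) x)%E \is a fin_num.
  apply: integrable_fin_num => //; apply: integrableS fi => //; exact: subDsetl.
rewrite lt_neqAle eq_sym fine_ge0// andbT; apply/eqP => h.
have h0 : (\int[mu]_(x in A `\` N) `|(EFin \o f) x| = 0)%E.
  transitivity (\int[mu]_(x in A `\` N) (EFin \o f) x)%E.
    apply: eq_integral => x /set_mem/fpos' /ltW h1.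
    by rewrite gee0_abs// lee_fin.
  by rewrite -(fineK fin) h.
move/ae_eq_integral_abs : h0 => /(_ mB) [].
  by apply: measurable_funS (measurable_int _ fi) => //; exact: subDsetl.
move=> Z [mZ Z0 sZ].
have : (mu A <= mu (Z `|` N))%E.
  apply: le_measure; rewrite ?inE//; first exact: measurableU.
  move=> x Ax; have [Nx|Nx] := pselect (N x); first by right.
  left; apply: sZ => /= /(_ (conj Ax Nx)) [] /eqP.
  by rewrite gt_eqF// fpos.
rewrite leNgt => /negP; apply; apply: le_lt_trans A0.
have ZN : (mu Z + mu N <= 0)%E by rewrite Z0 N0 adde0.
exact: le_trans (measureU2 mu mZ mN) ZN.
Qed.

Lemma ae_le0_Rintegral A N f : measurable A -> measurable N -> mu N = 0%E ->
  mu.-integrable A (EFin \o f) ->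
  (forall x, A x -> ~ N x -> f x <= 0) -> \int[mu]_(x in A) f x <= 0.
Proof.
move=> mA mN N0 fi fneg.
rewrite /Rintegral -/(EFin \o f) (negligible_integral mN mA fi N0).
rewrite (_ : (\int[mu]_(x in A `\` N) (EFin \o f) x)%E =
   (- \int[mu]_(x in A `\` N) (- f x)%:E)%E); last first.
  rewrite -integral_ge0N; last first.
    by move=> x [Ax Nx]; rewrite lee_fin oppr_ge0 fneg.
  by apply: eq_integral => x _ /=; rewrite opprK.
rewrite fineN oppr_le0 fine_ge0//; apply: integral_ge0 => x [Ax Nx].
by rewrite lee_fin oppr_ge0 fneg.
Qed.

Lemma ae_eq_Rintegral A N f g : measurable A -> measurable N -> mu N = 0%E ->
  mu.-integrable A (EFin \o f) -> mu.-integrable A (EFin \o g) ->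
  (forall x, A x -> ~ N x -> f x = g x) ->
  \int[mu]_(x in A) f x = \int[mu]_(x in A) g x.
Proof.
move=> mA mN N0 fi gi fg; rewrite /Rintegral -/(EFin \o f) -/(EFin \o g).
rewrite (negligible_integral mN mA fi N0) (negligible_integral mN mA gi N0).
congr fine; apply: eq_integral => x /set_mem[Ax Nx] /=.
by rewrite fg.
Qed.
End almost_everywhere.

(** * Lines, segments and polygonal boundaries are null *)

Section null_boundary.
Context {R : realType}.
Local Notation leb := (@lebesgue_measure R).
Local Notation mR := (measurableTypeR R).
Local Notation R2 := (mR * mR)%type.

(** A vertical line is a singleton times the whole axis, of measure [0 * +oo = 0]; any other line
    has singleton vertical sections. *)
Lemma negligible_line (v : R * R) (k : R) : v != 0 ->
  (leb2 R).-negligible [set x : R2 | aff v k x = 0].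
Proof.
move=> v0.
have mL : measurable [set x : R2 | aff v k x = 0].
  rewrite (_ : mkset _ = setT `&` (aff v k : R2 -> mR) @^-1` [set 0]).
    by apply: (measurable_aff v k) => //; exact: measurable_set1.
  by rewrite setTI.
apply/negligibleP => //.
have [v2|v2] := eqVneq v.2 0.
  have v1 : v.1 != 0.
    apply: contraNneq v0 => v1; rewrite [v]surjective_pairing v1 v2.
    exact/eqP.
  rewrite (_ : mkset _ = [set - k / v.1] `*` setT).
    have h := @product_measure1E _ _ mR mR R leb leb [set - k / v.1] setT
      (measurable_set1 _) measurableT.
    apply: (eq_trans h); apply: (eq_trans (congr1 (mule ^~ _) (lebesgue_measure_set1 _))).
    exact: mul0e.
  apply/seteqP; split => -[x y]; rewrite /aff /= v2 mul0r addr0.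
    move=> h; split => //; apply: (mulfI v1); rewrite [RHS]mulrC divfK//.
    by apply/eqP; rewrite -addr_eq0 h.
  by move=> [/= -> _]; field.
rewrite /product_measure1; apply: integral0_eq => x _ /=.
rewrite (_ : xsection _ _ = [set - (v.1 * x + k) / v.2]).
  exact: lebesgue_measure_set1.
apply/seteqP; split => y; rewrite /xsection/= inE/= /aff /=.
  move=> h; apply: (mulfI v2); rewrite [RHS]mulrC divfK//.
  by apply/eqP; rewrite -addr_eq0 -h; apply/eqP; ring.
by move=> ->; field.
Qed.

Lemma negligible_segment (x y : R * R) : (leb2 R).-negligible (segment x y : set R2).
Proof.
have [->|xy] := eqVneq x y.
  apply: (@negligibleS _ _ _ (leb2 R) [set z : R2 | aff (1, 0) (- y.1) z = 0]).
    move=> _ [s _ <-] /=; rewrite -scalerDl subrK scale1r /aff /=.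
    by ring.
  by apply: negligible_line; rewrite -pair_eqE /pair_eq/= oner_eq0.
apply: (@negligibleS _ _ _ (leb2 R)
  [set z : R2 | aff (y.2 - x.2, x.1 - y.1) (cross x y * -1) z = 0]).
  by move=> _ [s _ <-] /=; rewrite /aff /cross !pairE /=; ring.
apply: negligible_line; apply: contra xy; rewrite -!pair_eqE /pair_eq/=.
by rewrite !subr_eq0 eq_sym => /andP[-> ->].
Qed.

Lemma negligible_boundary (Om : set (R * R)) : polygonal_domain Om ->
  (leb2 R).-negligible (boundary Om : set R2).
Proof.
move=> [_ _ _ _ [s ->]]; rewrite bigcup_seq.
elim/big_ind : _ => [|A B|e _].
- exact: negligible_set0.
- exact: negligibleU.
- exact: negligible_segment.
Qed.

End null_boundary.

(** * Nodal basis functions *)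

Section elements.
Context {R : realType} {Om : set (R * R)} {ni nb : nat}.
Variable Th : triangulation Om ni nb.
Local Notation nv := (ni + nb)%N.
Local Notation a := (vtx Th).
Local Notation R2 := (measurableTypeR R * measurableTypeR R)%type.
Implicit Types (K : {set 'I_nv}) (i j k : 'I_nv).

Lemma elt_closure K : K \in elts Th -> elt Th K `<=` closure Om.
Proof. by move=> KT x Kx; rewrite (elts_cover Th); exists K. Qed.

Lemma measurable_elt K : K \in elts Th -> measurable (elt Th K : set R2).
Proof.
move=> KT; have [i [j [k E]]] := eltP KT; rewrite E in KT *.
by rewrite elt_tri//; apply: measurable_tri; exact: elt_det3.
Qed.

Lemma area_elt_gt0 K : K \in elts Th -> 0 < area (elt Th K).
Proof.
move=> KT; have [i [j [k E]]] := eltP KT; rewrite E in KT *.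
by rewrite elt_tri//; apply: area_tri_gt0; exact: elt_det3.
Qed.

Lemma leb2_elt K : K \in elts Th -> leb2 R (elt Th K) = (area (elt Th K))%:E.
Proof.
move=> KT; have [i [j [k E]]] := eltP KT; rewrite E in KT *.
by rewrite elt_tri//; apply: leb2_tri; exact: elt_det3.
Qed.

Lemma measurable_elts_bigcup (S : {set {set 'I_nv}}) : S \subset elts Th ->
  measurable (\bigcup_(K in [set` S]) elt Th K : set R2).
Proof.
move=> /fintype.subsetP sS; apply: fin_bigcup_measurable; first exact: finite_finset.
by move=> K /= KS; apply: measurable_elt; exact: sS.
Qed.

Lemma measurable_closure : measurable (closure Om : set R2).
Proof. by rewrite (elts_cover Th); apply: measurable_elts_bigcup. Qed.

(** Subadditivity gives the direction required: the patch area stands in the numerator of an upper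
    bound for [dt]. *)
Lemma patch_area_le i : patch_area Th i <= \sum_(K in Defs.patch Th i) area (elt Th K).
Proof.
have sub : Defs.patch Th i \subset elts Th.
  by apply/fintype.subsetP => K; rewrite inE => /andP[].
have : (leb2 R (\bigcup_(K in [set` Defs.patch Th i]) elt Th K)
        <= \sum_(K in Defs.patch Th i) (area (elt Th K))%:E)%E.
  rewrite bigcup_pred.
  suff : measurable (\big[setU/set0]_(K in Defs.patch Th i) (elt Th K : set R2)) /\
   (leb2 R (\big[setU/set0]_(K in Defs.patch Th i) (elt Th K : set R2))
        <= \sum_(K in Defs.patch Th i) (area (elt Th K))%:E)%E by case.
  elim/big_rec2 : _ => [|K A r KP [mA hA]]; first by rewrite measure0.
  have mK : measurable (elt Th K : set R2).
    by apply: measurable_elt; exact: (fintype.subsetP sub).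
  split; first exact: measurableU.
  apply: (le_trans (measureU2 (leb2 R) mK mA)); apply: leeD => //.
  by rewrite -leb2_elt//; exact: (fintype.subsetP sub).
rewrite sumEFin /patch_area /area => h; rewrite -lee_fin fineK// ge0_fin_numE//.
by apply: le_lt_trans h _; rewrite ltry.
Qed.

Variable phi : 'I_nv -> R * R -> R.
Hypothesis hphi : nodal_basis Th phi.

Lemma grad_phi K j : K \in elts Th ->
  has_grad (elt Th K) (phi j) (grad (elt Th K) (phi j)).
Proof.
by move=> KT; have [_ /(_ K KT) hv _] := hphi j; exact: xgetPex.
Qed.

Lemma phi_vtx i j : phi j (a i) = (i == j)%:R.
Proof. by have [_ _] := hphi j. Qed.

(** On an element the basis functions are the barycentric coordinates: [phi m] is affine there, with
    Kronecker values at the vertices. Sign, support and partition of unity all follow from this. *)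
Lemma phi_combo K m (l : 'I_nv -> R) : K \in elts Th ->
  (forall j, j \notin K -> l j = 0) -> (forall j, 0 <= l j) -> \sum_j l j = 1 ->
  phi m (\sum_j l j *: a j) = l m.
Proof.
move=> KT l0 lge l1; have [c hc] := grad_phi m KT.
set v := grad _ _ in hc.
have Kx : elt Th K (\sum_j l j *: a j) by exists l.
have f1 : (\sum_m l m *: a m).1 = \sum_m l m * (a m).1.
  by elim/big_rec2: _ => // i y1 y2 _ <-.
have f2 : (\sum_m l m *: a m).2 = \sum_m l m * (a m).2.
  by elim/big_rec2: _ => // i y1 y2 _ <-.
rewrite hc// dotE f1 f2.
transitivity (\sum_j l j * phi m (a j)).
  rewrite -[c]mul1r -l1 mulr_suml !mulr_sumr -!big_split/=.
  apply: eq_bigr => j _; have [jK|/l0 ->] := boolP (j \in K); last by rewrite !mul0r !mulr0 !addr0.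
  by rewrite (hc (a j)) ?dotE; [ring|exact: hull_vertex].
rewrite (bigD1 m)//= phi_vtx eqxx mulr1 big1 ?addr0// => j jm.
by rewrite phi_vtx (negbTE jm) mulr0.
Qed.

Lemma phi_ge0 K m x : K \in elts Th -> elt Th K x -> 0 <= phi m x.
Proof. by move=> KT [l [l0 lge l1 ->]]; rewrite (@phi_combo K). Qed.

Lemma phi_out K m x : K \in elts Th -> elt Th K x -> m \notin K -> phi m x = 0.
Proof. by move=> KT [l [l0 lge l1 ->]] mK; rewrite (@phi_combo K)// l0. Qed.

Lemma phi_sum K x : K \in elts Th -> elt Th K x -> \sum_m phi m x = 1.
Proof.
move=> KT [l [l0 lge l1 ->]]; rewrite -l1; apply: eq_bigr => m _.
by rewrite (@phi_combo K).
Qed.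

Lemma phi_le1 K m x : K \in elts Th -> elt Th K x -> phi m x <= 1.
Proof.
move=> KT Kx; rewrite -(phi_sum KT Kx) (bigD1 m)//= lerDl sumr_ge0// => j _.
exact: phi_ge0 Kx.
Qed.

Lemma phi_bary i j k x : [set i; j; k]%SET \in elts Th ->
  elt Th [set i; j; k]%SET x -> phi i x = bary (a i) (a j) (a k) x.
Proof.
move=> KT Kx; have u := elt_uniq KT; move: Kx => [l [l0 lge l1 ->]].
rewrite (@phi_combo [set i; j; k]%SET)// (sum_support3 u); last first.
  by move=> m /l0 ->; rewrite scale0r.
by rewrite baryE ?(elt_det3 KT)// -l1 (sum_support3 u).
Qed.

Lemma measurable_phi K m : K \in elts Th ->
  measurable_fun (elt Th K : set R2) (phi m : R2 -> measurableTypeR R).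
Proof.
move=> KT; have [c hc] := grad_phi m KT; set v := grad _ _ in hc.
have mm : measurable_fun (elt Th K : set R2) (aff (v 0 0, v 1 0) c : R2 -> measurableTypeR R).
  exact: measurable_aff.
apply: eq_measurable_fun mm => x /set_mem Kx.
by rewrite hc// dotE.
Qed.

Lemma bounded_phi K m : K \in elts Th -> [bounded phi m x | x in elt Th K].
Proof.
move=> KT; exists 1; split; first exact: num_real.
move=> y y1 x Kx /=; rewrite ger0_norm ?(phi_ge0 m KT Kx)//.
exact: le_trans (phi_le1 m KT Kx) (ltW y1).
Qed.

Lemma integrable_phi K m : K \in elts Th ->
  (leb2 R).-integrable (elt Th K) (EFin \o phi m).
Proof.
move=> KT; apply: measurable_bounded_integrable.
- exact: measurable_elt.
- have h : (leb2 R (elt Th K) < +oo)%E by rewrite leb2_elt// ltry.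
  exact: h.
- exact: measurable_phi.
- exact: bounded_phi.
Qed.

Lemma integrable_phi2 K m n : K \in elts Th ->
  (leb2 R).-integrable (elt Th K) (EFin \o (fun x => phi m x * phi n x)).
Proof.
move=> KT; have mK := measurable_elt KT.
exact: (integrableMl mK (integrable_phi m KT) (measurable_phi n KT) (bounded_phi n KT)).
Qed.

Lemma Rintegral_phi K i : K \in elts Th -> i \in K ->
  \int[leb2 R]_(x in elt Th K) phi i x = area (elt Th K) / 3.
Proof.
move=> KT iK; have [j [k E]] := elt_vertexP KT iK; rewrite E in KT *.
have -> : \int[leb2 R]_(x in elt Th [set i; j; k]%SET) phi i x =
    \int[leb2 R]_(x in elt Th [set i; j; k]%SET) bary (a i) (a j) (a k) x.
  by apply: eq_Rintegral => x /set_mem; exact: phi_bary.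
by rewrite elt_tri// Rintegral_bary// elt_det3.
Qed.

Lemma Rintegral_phi_out K i : K \in elts Th -> i \notin K ->
  \int[leb2 R]_(x in elt Th K) phi i x = 0.
Proof.
move=> KT iK; rewrite (@eq_Rintegral _ _ _ _ _ (cst 0)) ?Rintegral_cst ?mul0r//.
  exact: measurable_elt.
by move=> x /set_mem Kx; exact: phi_out iK.
Qed.

(** Summing over [j] replaces [phi j] by the constant 1 on each element, leaving the integral of
    [phi i]. *)
Lemma lumped_entry i : \sum_j mass Th phi i j =
  \sum_(K in Defs.patch Th i) area (elt Th K) / 3.
Proof.
rewrite /mass exchange_big/= [RHS](eq_bigl (fun K => (K \in elts Th) && (i \in K))); last first.
  by move=> K; rewrite inE.
rewrite [RHS]big_mkcondr /=; apply: eq_bigr => K KT.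
have mK := measurable_elt KT.
have -> : \sum_j \int[leb2 R]_(x in elt Th K) (phi j x * phi i x) =
    \int[leb2 R]_(x in elt Th K) phi i x.
  have [x [y [z E]]] := eltP KT; rewrite (sum_support3 (_ : uniq [:: x; y; z])); last 2 first.
  - by apply: (@elt_uniq _ _ _ _ Th); rewrite -E.
  - move=> m mK'; rewrite -E in mK'.
    rewrite (@eq_Rintegral _ _ _ _ _ (cst 0)) ?Rintegral_cst ?mul0r//.
    by move=> p /set_mem Kp; rewrite (phi_out KT Kp mK') mul0r.
  rewrite -RintegralD//; try exact: integrable_phi2.
  rewrite -RintegralD//; last 2 first.
  - have := integrableD mK (integrable_phi2 x i KT) (integrable_phi2 y i KT).
    by apply: eq_integrable.
  - exact: integrable_phi2.
  apply: eq_Rintegral => p /set_mem Kp.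
  rewrite -!mulrDl -[RHS]mul1r -(phi_sum KT Kp) (sum_support3 (_ : uniq [:: x; y; z]))//.
    by apply: (@elt_uniq _ _ _ _ Th); rewrite -E.
  by rewrite -E => m mK'; rewrite (phi_out KT Kp mK').
by case: ifPn => iK; [rewrite Rintegral_phi|rewrite Rintegral_phi_out].
Qed.

Lemma fem_fun_le (u : 'cV[R]_nv) (C : R) x : closure Om x ->
  (forall j, u j 0 <= C) -> fem_fun phi u x <= C.
Proof.
rewrite (elts_cover Th) => -[K /= KT Kx] uC.
rewrite /fem_fun -[leRHS]mulr1 -(phi_sum KT Kx) mulr_sumr; apply: ler_sum => j _.
by rewrite ler_wpM2r// (phi_ge0 _ KT Kx).
Qed.

Lemma fem_fun_vtx (u : 'cV[R]_nv) j : fem_fun phi u (a j) = u j 0.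
Proof.
rewrite /fem_fun (bigD1 j)//= phi_vtx eqxx mulr1 big1 ?addr0// => m mj.
by rewrite phi_vtx eq_sym (negbTE mj) mulr0.
Qed.

End elements.

(** * Stiffness matrix *)

Section height.
Context {R : realType} {Om : set (R * R)} {ni nb : nat}.
Variable Th : triangulation Om ni nb.
Local Notation nv := (ni + nb)%N.
Local Notation a := (vtx Th).
Implicit Types (K : {set 'I_nv}) (i j k : 'I_nv).

Lemma gvec_neq0 (x y z : R * R) : det3 x y z != 0 -> gvec x y z != 0.
Proof.
move=> d0; rewrite /gvec colv_eq0 -pair_eqE /pair_eq/= !mulf_eq0 !invr_eq0 (negbTE d0) !orbF.
apply: contra d0; rewrite !subr_eq0 => /andP[/eqP h1 /eqP h2].
by rewrite /det3 /cross !pairE h1 h2; apply/eqP; ring.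
Qed.

(** Every [y] on the opposite line satisfies [g . (a i - y) = 1], so Cauchy-Schwarz bounds the
    distance below by [1 / |g|]. *)
Lemma height_gvec i j k (g := gvec (a i) (a j) (a k)) :
  [set i; j; k]%SET \in elts Th ->
  height Th [set i; j; k]%SET i ^- 2 = g 0 0 ^+ 2 + g 1 0 ^+ 2.
Proof.
move=> KT; have d0 := elt_det3 KT; have u := elt_uniq KT.
have := u; rewrite /= !inE negb_or andbT => /andP[/andP[ij ik] jk].
set G := g 0 0 ^+ 2 + g 1 0 ^+ 2.
have G0 : 0 < G.
  rewrite lt_neqAle eq_sym addr_ge0 ?sqr_ge0// andbT.
  apply: contra (gvec_neq0 d0); rewrite paddr_eq0 ?sqr_ge0// !sqrf_eq0 => /andP[/eqP h1 /eqP h2].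
  by rewrite -[gvec _ _ _]colvK h1 h2 colv_eq0.
have rG : 0 < Num.sqrt G by rewrite sqrtr_gt0.
pose A := [set enorm (a i - y) | y in affine_span a ([set i; j; k] :\ i)%SET].
have lbA : lbound A (Num.sqrt G)^-1.
  move=> _ [y [l [l0 l1 ->]] <-].
  have li : l i = 0 by apply: l0; rewrite !inE eqxx.
  have l0' m : m \notin [set i; j; k]%SET -> l m = 0.
    by move=> h; apply: l0; move: h; rewrite !inE !negb_or => /andP[/andP[/negbTE -> /negbTE ->] /negbTE ->]; rewrite andbF.
  rewrite (sum_support3 u); last by move=> m /l0' ->; rewrite scale0r.
  move: l1; rewrite (sum_support3 u l0') li add0r scale0r add0r => l1.
  set z := a i - _.
  have gz : g 0 0 * z.1 + g 1 0 * z.2 = 1.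
    rewrite /g /gvec !(colv0, colv1) /z !pairE /=.
    have -> : l j = 1 - l k by rewrite -l1; ring.
    move: d0; rewrite /det3 /cross !pairE => d0; field; exact: d0.
  rewrite /enorm -(sqrtrV (ltW G0)) ler_sqrt ?addr_ge0 ?sqr_ge0//.
  rewrite -[leLHS]div1r ler_pdivrMr//.
  rewrite -[leLHS](expr1n _ 2) -gz -subr_ge0.
  have : 0 <= (g 0 0 * z.2 - g 1 0 * z.1) ^+ 2 by exact: sqr_ge0.
  by congr (0 <= _); rewrite /G; ring.
have A0 : A (Num.sqrt G)^-1.
  (* The foot of the perpendicular, [a i - g / |g|^2], where the lower bound is attained. *)
  pose y := (((a i).1 - g 0 0 / G, (a i).2 - g 1 0 / G) : R * R).
  exists y; last first.
    rewrite /enorm /y !pairE /= -(sqrtrV (ltW G0)); congr Num.sqrt.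
    rewrite (_ : _ + _ = (g 0 0 ^+ 2 + g 1 0 ^+ 2) / G ^+ 2).
      by rewrite -/G; field; rewrite gt_eqF.
    by field; rewrite gt_eqF.
  have by0 : bary (a i) (a j) (a k) y = 0.
    have : bary (a i) (a j) (a k) (a i) = 1 by rewrite /bary divff.
    have g00 : g 0 0 = ((a j).2 - (a k).2) / det3 (a i) (a j) (a k) by rewrite colv0.
    have g10 : g 1 0 = ((a k).1 - (a j).1) / det3 (a i) (a j) (a k) by rewrite colv1.
    rewrite bary_aff /aff /= -g00 -g10 => h.
    transitivity (1 - G / G : R); last by rewrite divff ?subrr// gt_eqF.
    have GE : G = g 0 0 ^+ 2 + g 1 0 ^+ 2 by [].
    by rewrite -h [X in _ = _ - X * _]GE; ring.
  have := bary_combo y d0; have := bary_sum y d0; rewrite by0 add0r scale0r add0r => s1 yE.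
  pose l m := if m == j then bary (a j) (a k) (a i) y
              else if m == k then bary (a k) (a i) (a j) y else 0.
  have li : l i = 0 by rewrite /l (negbTE ij) (negbTE ik).
  have lj : l j = bary (a j) (a k) (a i) y by rewrite /l eqxx.
  have lk : l k = bary (a k) (a i) (a j) y by rewrite /l eqxx eq_sym (negbTE jk).
  have l0 m : m \notin [set i; j; k]%SET -> l m = 0.
    by rewrite !inE !negb_or /l => /andP[/andP[_ /negbTE ->] /negbTE ->].
  exists l; split.
  - move=> m; rewrite !inE /l; case: eqVneq => [-> _|mi /=].
      by rewrite (negbTE ij) (negbTE ik).
    by rewrite negb_or => /andP[/negbTE -> /negbTE ->].
  - by rewrite (sum_support3 u)// li lj lk add0r.
  - rewrite (sum_support3 u) ?li ?lj ?lk ?scale0r ?add0r//.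
    by move=> m /l0 ->; rewrite scale0r.
have -> : height Th [set i; j; k]%SET i = (Num.sqrt G)^-1.
  apply/eqP; rewrite eq_le; apply/andP; split.
    by apply: ge_inf => //; exists (Num.sqrt G)^-1.
  by apply: lb_le_inf => //; exists (Num.sqrt G)^-1.
by rewrite exprVn invrK sqr_sqrtr// ltW.
Qed.
End height.

Section stiffness.
Context {R : realType} {Om : set (R * R)} {ni nb : nat}.
Variable Th : triangulation Om ni nb.
Hypothesis hOm : polygonal_domain Om.
Local Notation nv := (ni + nb)%N.
Local Notation a := (vtx Th).
Local Notation R2 := (measurableTypeR R * measurableTypeR R)%type.
Implicit Types (K : {set 'I_nv}) (i j k : 'I_nv).

Lemma null_outside : exists N : set R2, [/\ measurable N, leb2 R N = 0%E &
  forall K x, K \in elts Th -> elt Th K x -> ~ N x -> Om x].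
Proof.
have [N [mN N0 sN]] := negligible_boundary hOm.
exists N; split => // K x KT Kx Nx; apply: interior_subset; apply: contrapT => ix.
by apply: Nx; apply: sN; split => //; exact: elt_closure Kx.
Qed.

Variable D : R * R -> 'M[R]_2.
Hypothesis D_spd : forall x, Om x -> spd (D x).
Hypothesis D_int : forall p q,
  (leb2 R).-integrable (closure Om) (fun x => (D x p q)%:E).

Lemma integrable_elt (f : R2 -> R) K : K \in elts Th ->
  (leb2 R).-integrable (closure Om) (EFin \o f) ->
  (leb2 R).-integrable (elt Th K) (EFin \o f).
Proof.
move=> KT; apply: integrableS.
- exact: (measurable_closure Th).
- exact: measurable_elt.
- exact: elt_closure.
Qed.

(** Averaging commutes with evaluating the quadratic form at a fixed vector; symmetry and strict
    positivity survive because [D] has them off a null set. *)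
Lemma spd_meanD K : K \in elts Th -> spd (meanD Th D K).
Proof.
move=> KT; have [N [mN N0 NO]] := null_outside.
have mK := measurable_elt KT.
have DI p q := integrable_elt KT (D_int p q : (leb2 R).-integrable (closure Om) (EFin \o (fun x => D x p q))).
have aK := area_elt_gt0 KT.
pose I p q := \int[leb2 R]_(x in elt Th K) D x p q.
have IC : I 1 0 = I 0 1.
  apply: (ae_eq_Rintegral mK mN N0) => // x Kx Nx.
  by apply: spd_sym; apply: D_spd; exact: NO Kx Nx.
have ME p q : meanD Th D K p q = (area (elt Th K))^-1 * I p q by rewrite mxE.
split.
  apply/matrixP => p q; rewrite mxE !ME; congr (_ * _).
  have o2 (r : 'I_2) : r = 0 \/ r = 1.
    by case: r => -[|[|//]] hr; [left|right]; exact/val_inj.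
  by case: (o2 p) => ->; case: (o2 q) => ->.
move=> v v0.
have ZI p q (c : R) : (leb2 R).-integrable (elt Th K) (EFin \o (fun x => D x p q * c)).
  by have := integrableZr mK c (DI p q); apply: eq_integrable.
have DI2 p q c p' q' c' : (leb2 R).-integrable (elt Th K)
    (EFin \o (fun x => D x p q * c + D x p' q' * c')).
  by have := integrableD mK (ZI p q c) (ZI p' q' c'); apply: eq_integrable.
pose c00 := v 0 0 * v 0 0; pose c01 := v 0 0 * v 1 0; pose c11 := v 1 0 * v 1 0.
have hI : \int[leb2 R]_(x in elt Th K) bilin (D x) v v =
    I 0 0 * c00 + I 0 1 * c01 + (I 1 0 * c01 + I 1 1 * c11).
  rewrite /I -!RintegralZr// -!RintegralD//.
  by apply: eq_Rintegral => x _; rewrite bilinE /c00 /c01 /c11; ring.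
have -> : bilin (meanD Th D K) v v =
    (area (elt Th K))^-1 * \int[leb2 R]_(x in elt Th K) bilin (D x) v v.
  by rewrite hI bilinE !ME /c00 /c01 /c11; ring.
rewrite mulr_gt0 ?invr_gt0//.
apply: (ae_gt0_Rintegral mK mN N0).
- have h : (0 < leb2 R (elt Th K))%E by rewrite leb2_elt// lte_fin.
  exact: h.
- have := integrableD mK (DI2 0 0 c00 0 1 c01) (DI2 1 0 c01 1 1 c11).
  by apply: eq_integrable => // x _ /=; congr EFin; rewrite bilinE /c00 /c01 /c11; ring.
- by move=> x Kx Nx; have [_] := D_spd (NO _ _ KT Kx Nx); exact.
Qed.

Variable phi : 'I_nv -> R * R -> R.
Hypothesis hphi : nodal_basis Th phi.

Lemma load_le0 (f : R * R -> R -> R) t i :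
  (leb2 R).-integrable (closure Om) (fun x => (f x t)%:E) ->
  (forall x, Om x -> f x t <= 0) -> load Th phi f t i <= 0.
Proof.
move=> fi f0; have [N [mN N0 NO]] := null_outside.
apply: sumr_le0 => K KT; have mK := measurable_elt KT.
apply: (ae_le0_Rintegral mK mN N0).
  have fiK := integrable_elt KT (fi : (leb2 R).-integrable (closure Om) (EFin \o (fun x => f x t))).
  exact: (integrableMl mK fiK (measurable_phi hphi i KT) (bounded_phi hphi i KT)).
move=> x Kx Nx; rewrite mulr_le0_ge0 ?(phi_ge0 hphi i KT Kx)//.
by apply: f0; exact: NO Kx Nx.
Qed.

Lemma grad_phiE i j k m (K := [set i; j; k]%SET) : K \in elts Th ->
  grad (elt Th K) (phi m) =
    (i == m)%:R *: gvec (a i) (a j) (a k) + (j == m)%:R *: gvec (a j) (a k) (a i)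
    + (k == m)%:R *: gvec (a k) (a i) (a j).
Proof.
move=> KT; have d0 := elt_det3 KT.
have V x : x \in K -> elt Th K (a x) by exact: hull_vertex.
rewrite -!(phi_vtx hphi); apply: (has_gradE d0); last exact: (grad_phi hphi).
- by apply: V; rewrite !inE eqxx.
- by apply: V; rewrite !inE eqxx orbT.
- by apply: V; rewrite !inE eqxx orbT.
Qed.

Lemma grad_phi_out K m : K \in elts Th -> m \notin K -> grad (elt Th K) (phi m) = 0.
Proof.
move=> KT; have [i [j [k E]]] := eltP KT; rewrite E in KT *.
rewrite !inE !negb_or grad_phiE// => /andP[/andP[mi mj] mk].
by rewrite ![_ == m]eq_sym (negbTE mi) (negbTE mj) (negbTE mk) !scale0r !addr0.
Qed.

Lemma grad_phi_gvec i j k (K := [set i; j; k]%SET) : K \in elts Th ->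
  grad (elt Th K) (phi i) = gvec (a i) (a j) (a k).
Proof.
move=> KT; have := elt_uniq KT; rewrite /= !inE negb_or andbT => /andP[/andP[ij ik] _].
by rewrite grad_phiE// eqxx ![_ == i]eq_sym (negbTE ij) (negbTE ik) scale1r !scale0r !addr0.
Qed.

Lemma set3C i j k : [set i; j; k]%SET = [set j; k; i]%SET.
Proof. by apply/finset.setP => m; rewrite !inE -orbA orbC. Qed.

Lemma grad_phi_gvec2 i j k (K := [set i; j; k]%SET) : K \in elts Th ->
  grad (elt Th K) (phi j) = gvec (a j) (a k) (a i).
Proof. by rewrite /K set3C; exact: grad_phi_gvec. Qed.

Lemma grad_phi_gvec3 i j k (K := [set i; j; k]%SET) : K \in elts Th ->
  grad (elt Th K) (phi k) = gvec (a k) (a i) (a j).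
Proof. by rewrite /K set3C; exact: grad_phi_gvec2. Qed.

Lemma sum_grad_phi K : K \in elts Th -> \sum_m grad (elt Th K) (phi m) = 0.
Proof.
move=> KT; have [i [j [k E]]] := eltP KT; rewrite E in KT *.
have u := elt_uniq KT; rewrite (sum_support3 u); last by move=> m; exact: grad_phi_out.
rewrite grad_phi_gvec// grad_phi_gvec2// grad_phi_gvec3//.
exact: gvec_sum (elt_det3 KT).
Qed.

Lemma bilin0r (M : 'M[R]_2) v : bilin M v 0 = 0.
Proof. by rewrite /bilin mulmx0 mxE. Qed.

Lemma bilin0l (M : 'M[R]_2) v : bilin M 0 v = 0.
Proof. by rewrite /bilin trmx0 !mul0mx mxE. Qed.

Lemma bilin_sumr (M : 'M[R]_2) v (J : finType) (w : J -> 'cV[R]_2) :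
  bilin M v (\sum_m w m) = \sum_m bilin M v (w m).
Proof. by rewrite /bilin mulmx_sumr summxE. Qed.

(** On each element the gradients of a partition of unity sum to zero. *)
Lemma stiff_row_sum i : \sum_j stiff Th phi D i j = 0.
Proof.
rewrite /stiff exchange_big/= big1// => K KT.
by rewrite -mulr_sumr -bilin_sumr sum_grad_phi// bilin0r mulr0.
Qed.

Lemma stiff_edge i j k (K := [set i; j; k]%SET) : K \in elts Th ->
  area (elt Th K) * bilin (meanD Th D K) (grad (elt Th K) (phi i)) (grad (elt Th K) (phi j))
  = - (area (elt Th K) / `|det3 (a i) (a j) (a k)|) *
    (Num.sqrt (\det (meanD Th D K)) * cot (opp_angle Th D i j k)).
Proof.
move=> KT; rewrite grad_phi_gvec// grad_phi_gvec2//.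
rewrite (bilin_gvec (spd_meanD KT) (elt_det3 KT)) /opp_angle -/K.
by field; rewrite normr_eq0 elt_det3.
Qed.

Lemma stiff_le0 i j : delaunay_type Th D -> Om (a i) -> j != i ->
  stiff Th phi D i j <= 0.
Proof.
move=> mesh Omi ji.
have [/existsP[K /and3P[KT iK jK]]|none] :=
    boolP [exists K, [&& K \in elts Th, i \in K & j \in K]]; last first.
  rewrite /stiff big1// => K KT; move/existsPn/(_ K): none; rewrite KT/= negb_and.
  by move=> /orP[iK|jK]; rewrite ?(grad_phi_out KT iK) ?(grad_phi_out KT jK) ?bilin0l ?bilin0r mulr0.
have ij : i != j by rewrite eq_sym.
have [k KE] := elt_edgeP KT iK jK ij; rewrite {}KE in KT iK jK.
have [hopen _ _ _ _] := hOm.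
have [k' [KT' kk' only]] := second_element hopen KT Omi.
have d0 := elt_det3 KT; have d0' := elt_det3 KT'.
have KK' : [set i; j; k']%SET != [set i; j; k]%SET.
  apply: contra kk' => /eqP E; have : k \in [set i; j; k']%SET by rewrite E !inE eqxx orbT.
  have := elt_uniq KT; rewrite /= !inE negb_or andbT => /andP[/andP[_ ik] jk].
  by rewrite ![k == _]eq_sym (negbTE ik) (negbTE jk)/= eq_sym.
have -> : stiff Th phi D i j =
   - (area (elt Th [set i; j; k]%SET) / `|det3 (a i) (a j) (a k)|) *
    (Num.sqrt (\det (meanD Th D [set i; j; k]%SET)) * cot (opp_angle Th D i j k)) +
   - (area (elt Th [set i; j; k']%SET) / `|det3 (a i) (a j) (a k')|) *
    (Num.sqrt (\det (meanD Th D [set i; j; k']%SET)) * cot (opp_angle Th D i j k')).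
  rewrite -!stiff_edge// /stiff (bigD1 [set i; j; k]%SET)//= (bigD1 [set i; j; k']%SET)/=; last first.
    by rewrite KT' KK'.
  rewrite big1 ?addr0// => L /andP[/andP[LT /eqP L1] /eqP L2].
  have [iL|iL] := boolP (i \in L); last by rewrite (grad_phi_out LT iL) bilin0l mulr0.
  have [jL|jL] := boolP (j \in L); last by rewrite (grad_phi_out LT jL) bilin0r mulr0.
  by case: (only L LT iL jL).
have -> : area (elt Th [set i; j; k']%SET) / `|det3 (a i) (a j) (a k')| =
          area (elt Th [set i; j; k]%SET) / `|det3 (a i) (a j) (a k)|.
  have := area_tri_ratio d0 d0'; rewrite !elt_tri// => E.
  apply: (mulIf (_ : `|det3 (a i) (a j) (a k)| * `|det3 (a i) (a j) (a k')| != 0)).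
    by rewrite mulf_neq0// normr_eq0.
  rewrite [RHS]mulrA divfK ?normr_eq0// [X in _ * X = _]mulrC mulrA divfK ?normr_eq0//.
rewrite -mulrDr mulNr oppr_le0 mulr_ge0//.
  by rewrite divr_ge0// ltW// area_elt_gt0.
have A (l : 'I_nv) : [set i; j; l]%SET \in elts Th -> 0 < opp_angle Th D i j l < pi.
  move=> LT; have c0 : cross (a i - a l) (a j - a l) != 0.
    by rewrite -[cross _ _]/(det3 (a l) (a i) (a j)) det3C elt_det3.
  by have [] := cot_angle (spd_meanD LT) c0.
apply: delaunay_cot (A _ KT) (A _ KT') (spd_det_gt0 (spd_meanD KT))
  (spd_det_gt0 (spd_meanD KT')) _.
(* The endpoint [a i] lies in the open set [Om], hence off its boundary, so the edge is interior and
   the angle condition applies. *)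
apply: mesh => // seg; have [_] : boundary Om (a i).
  apply: seg; exists 0; first by rewrite /= in_itv/= lexx ler01.
  by rewrite subr0 scale1r scale0r addr0.
by apply; rewrite ((interior_id Om).1 hopen).
Qed.

Lemma stiff_diag_le i : stiff Th phi D i i <=
  \sum_(K in Defs.patch Th i)
     area (elt Th K) * lambda_max (meanD Th D K) * (height Th K i) ^- 2.
Proof.
rewrite /stiff [leRHS](eq_bigl (fun K => (K \in elts Th) && (i \in K))); last first.
  by move=> K; rewrite inE.
rewrite [leRHS]big_mkcondr /=; apply: ler_sum => K KT.
case: ifPn => iK; last by rewrite (grad_phi_out KT iK) bilin0l mulr0.
have [j [k E]] := elt_vertexP KT iK; rewrite E in KT *.
rewrite -mulrA ler_wpM2l ?(ltW (area_elt_gt0 KT))// grad_phi_gvec// height_gvec//.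
by apply: lambda_max_ge; exact: spd_meanD.
Qed.

(** With [stiff_diag_le], this makes the denominator in the time step bound positive, which allows
    cross-multiplication. *)
Lemma stiff_diag_gt0 i : 0 < stiff Th phi D i i.
Proof.
have pos K : K \in elts Th -> i \in K -> 0 < area (elt Th K) *
    bilin (meanD Th D K) (grad (elt Th K) (phi i)) (grad (elt Th K) (phi i)).
  move=> KT iK; have [j [k E]] := elt_vertexP KT iK; rewrite E in KT *.
  rewrite mulr_gt0 ?area_elt_gt0// grad_phi_gvec//.
  by have [_] := spd_meanD KT; apply; apply: gvec_neq0; exact: elt_det3.
have [K KT iK] := vtx_used Th i.
rewrite /stiff (bigD1 K)//= ltr_pwDl ?pos// sumr_ge0// => L /andP[LT _].
have [iL|iL] := boolP (i \in L); first by rewrite ltW// pos.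
by rewrite (grad_phi_out LT iL) bilin0l mulr0.
Qed.
End stiffness.

(** * Discrete maximum principle *)

Section discrete_maximum.
Context {R : realType} {ni nb : nat}.

(* At the interior index where [u'] is largest, the implicit terms have a
   favourable sign; no inversion of the system matrix is involved. *)
Lemma discrete_max_step (m : 'I_ni -> R) (S : 'I_ni -> 'I_(ni + nb) -> R)
    (r : 'I_ni -> R) (s t C : R) (u u' : 'I_(ni + nb) -> R) :
  0 <= s -> 0 <= t ->
  (forall i, 0 < m i) -> (forall i, r i <= 0) ->
  (forall i j, j != lshift nb i -> S i j <= 0) ->
  (forall i, \sum_j S i j = 0) ->
  (forall i, t * S i (lshift nb i) <= m i) ->
  (forall i, m i * u' (lshift nb i) + s * \sum_j S i j * u' j =
             m i * u (lshift nb i) - t * \sum_j S i j * u j + r i) ->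
  (forall j, u j <= C) -> (forall j, u' (rshift ni j) <= C) ->
  forall i, u' (lshift nb i) <= C.
Proof.
move=> s0 t0 m0 r0 S0 S1 mS row uC bC i0.
case: (@arg_maxP _ _ _ i0 xpredT (fun i => u' (lshift nb i)) isT) => i _ imax.
apply: le_trans (imax i0 isT) _; rewrite leNgt; apply/negP => ltC.
(* The maximum is taken over interior indices; exceeding [C], it also dominates the boundary
   values. *)
have max j : u' j <= u' (lshift nb i).
  case: (split_ordP j) => k ->; first exact: imax.
  exact: le_trans (bC k) (ltW ltC).
(* Zero row sums allow any constant to be subtracted: the new maximum in the implicit sum, [C] in
   the explicit one. Each off-diagonal term is then a product of two nonpositive factors. *)
have shift (v : 'I_(ni + nb) -> R) c :
    \sum_j S i j * v j = \sum_j S i j * (v j - c).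
  under [RHS]eq_bigr do rewrite mulrBr.
  by rewrite sumrB -mulr_suml S1 mul0r subr0.
have lhs : 0 <= \sum_j S i j * u' j.
  rewrite (shift _ (u' (lshift nb i))); apply: sumr_ge0 => j _.
  have [->|ji] := eqVneq j (lshift nb i); first by rewrite subrr mulr0.
  by rewrite mulr_le0// ?subr_le0// S0.
have rhs : S i (lshift nb i) * (u (lshift nb i) - C) <= \sum_j S i j * u j.
  rewrite (shift _ C) [leRHS](bigD1 (lshift nb i))//= lerDl.
  by apply: sumr_ge0 => j ji; rewrite mulr_le0// ?subr_le0// S0.
have h1 : m i * C < m i * u' (lshift nb i) by rewrite ltr_pM2l.
have h2 : 0 <= s * \sum_j S i j * u' j by rewrite mulr_ge0.
have h3 := ler_wpM2l t0 rhs.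
have h4 : (m i - t * S i (lshift nb i)) * (u (lshift nb i) - C) <= 0.
  by rewrite mulr_ge0_le0// ?subr_ge0// subr_le0.
have := row i; have := r0 i; move: h1 h2 h3 h4.
lra.
Qed.
End discrete_maximum.

Section scheme_bounds.
Context {R : realType} {Om : set (R * R)} {ni nb : nat}.
Variable Th : triangulation Om ni nb.
Variable phi : 'I_(ni + nb) -> R * R -> R.
Local Notation a := (vtx Th).

Lemma lumped_scheme_row D f g u0 theta dt N (u : nat -> 'cV[R]_(ni + nb)) n i :
  lumped_scheme Th phi D f g u0 theta dt N u -> (n < N)%N ->
  let i' := lshift nb i in
  (\sum_j mass Th phi i' j) * u n.+1 i' 0
    + theta * dt * \sum_j stiff Th phi D i' j * u n.+1 j 0
  = (\sum_j mass Th phi i' j) * u n i' 0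
    - (1 - theta) * dt * \sum_j stiff Th phi D i' j * u n j 0
    + dt * load Th phi f (n%:R * dt + theta * dt) i'.
Proof.
move=> [_ h] /h {h}/(congr1 (fun w : 'cV[R]_(ni + nb) => w (lshift nb i) 0)).
set S := stiffness Th phi D; set L := lumped_mass Th phi.
have E : block_mx (lsubmx S) (rsubmx S) 0 0 = col_mx S (0 : 'M[R]_(nb, ni + nb)).
  by rewrite block_mxEv hsubmxK row_mx0.
have ES (c : R) (w : 'cV[R]_(ni + nb)) : (c *: col_mx S (0 : 'M[R]_(nb, ni + nb)) *m w) (lshift nb i) 0
    = c * \sum_j stiff Th phi D (lshift nb i) j * w j 0.
  rewrite -scalemxAl mxE mul_col_mx col_mxEu mxE; congr (_ * _).
  by apply: eq_bigr => j _; rewrite mxE.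
have EL (X : 'M[R]_nb) (w : 'cV[R]_(ni + nb)) : (block_mx L 0 0 X *m w) (lshift nb i) 0 =
    (\sum_j mass Th phi (lshift nb i) j) * w (lshift nb i) 0.
  rewrite -[w in LHS]vsubmxK mul_block_col col_mxEu mul0mx addr0.
  by rewrite /L /lumped_mass mul_diag_mx !mxE.
rewrite /= E mulmxDl mulmxBl.
rewrite [LHS]mxE [RHS]mxE [X in X + _ = _]EL [X in _ + X = _]ES.
rewrite [X in _ = X + _]mxE [X in _ = X + _ + _]EL [X in _ = _ + X + _]mxE [X in _ = _ - X + _]ES.
by rewrite [X in _ = _ + X]mxE /rhs col_mxEu mxE.
Qed.

Lemma time_step_le D theta dt i : polygonal_domain Om ->
  (forall x, Om x -> spd (D x)) ->
  (forall p q, (leb2 R).-integrable (closure Om) (fun x => (D x p q)%:E)) ->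
  nodal_basis Th phi ->
  0 < theta <= 1 -> 0 < dt -> (dt%:E <= time_step_bound Th D theta)%E ->
  (1 - theta) * dt * stiff Th phi D (lshift nb i) (lshift nb i)
    <= \sum_j mass Th phi (lshift nb i) j.
Proof.
move=> hOm Dspd Dint hphi /andP[th0 th1] dt0.
have parea := patch_area_le Th (lshift nb i).
have sd := stiff_diag_le hOm Dspd Dint hphi (lshift nb i).
have sg := stiff_diag_gt0 hOm Dspd Dint hphi (lshift nb i).
rewrite lumped_entry// -mulr_suml.
have m0 : 0 <= \sum_(K in Defs.patch Th (lshift nb i)) area (elt Th K).
  by apply: sumr_ge0 => K; rewrite inE => /andP[KT _]; rewrite ltW// area_elt_gt0.
(* For [theta = 1] the bound is [+oo], but the explicit stiffness term vanishes as well. *)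
rewrite /time_step_bound; case: eqVneq => [-> _|th].
  by rewrite subrr !mul0r divr_ge0.
have th2 : 0 < 1 - theta by rewrite subr_gt0 lt_neqAle th.
set Q := \sum_(K in _) _ * _ in sd.
move=> h.
have : (dt%:E <= (1 / (3 * (1 - theta)))%:E * (patch_area Th (lshift nb i) / Q)%:E)%E.
  apply: le_trans h _; apply: lee_wpmul2l.
    by rewrite lee_fin divr_ge0// mulr_ge0// ltW.
  exact: (bigmin_inf i).
have Q0 : 0 < Q by exact: lt_le_trans sd.
rewrite -EFinM lee_fin mulf_div mul1r ler_pdivlMr ?mulr_gt0// => h2.
have h3 : (1 - theta) * dt * stiff Th phi D (lshift nb i) (lshift nb i) <= (1 - theta) * dt * Q.
  by rewrite ler_wpM2l// mulr_ge0// ltW.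
apply: le_trans h3 _; rewrite ler_pdivlMr//; apply: le_trans parea.
by move: h2; congr (_ <= _); ring.
Qed.

Lemma fem_fun_nodal_bound D f g u0 theta dt N (u : nat -> 'cV[R]_(ni + nb)) T C :
  polygonal_domain Om ->
  (forall x, Om x -> spd (D x)) ->
  (forall p q, (leb2 R).-integrable (closure Om) (fun x => (D x p q)%:E)) ->
  nodal_basis Th phi ->
  0 < theta <= 1 -> 0 < dt -> N%:R * dt <= T ->
  delaunay_type Th D ->
  (dt%:E <= time_step_bound Th D theta)%E ->
  (forall t, 0 < t <= T ->
     (leb2 R).-integrable (closure Om) (fun x => (f x t)%:E)) ->
  (forall x t, Om x -> 0 < t <= T -> f x t <= 0) ->
  lumped_scheme Th phi D f g u0 theta dt N u ->
  (forall j, u 0%N j 0 <= C) ->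
  (forall n j, (0 < n <= N)%N -> u n (rshift ni j) 0 <= C) ->
  forall n j, (n <= N)%N -> u n j 0 <= C.
Proof.
move=> hOm Dspd Dint hphi hth dt0 NT mesh hdt fint f0 hu C0 Cb.
have /andP[th0 th1] := hth.
elim=> [|n IH] j; first by [].
move=> nN.
have bC k : u n.+1 (rshift ni k) 0 <= C by exact: Cb.
case: (split_ordP j) => k -> //.
(* The sign of [f] is known on [(0, T]] only: [theta > 0] excludes time 0 at the first step, and
   [theta <= 1] keeps the time at most [N * dt]. *)
have tn : 0 < n%:R * dt + theta * dt <= T.
  apply/andP; split; first by rewrite ltr_wpDl ?mulr_ge0 ?mulr_gt0 ?ler0n// ltW.
  apply: le_trans NT; rewrite -mulrDl ler_pM2r//.
  by apply: (@le_trans _ _ (n.+1%:R)); [rewrite -natr1 lerD2l|rewrite ler_nat].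
apply: (@discrete_max_step _ _ _ (fun i => \sum_j mass Th phi (lshift nb i) j)
  (fun i => stiff Th phi D (lshift nb i))
  (fun i => dt * load Th phi f (n%:R * dt + theta * dt) (lshift nb i))
  (theta * dt) ((1 - theta) * dt) C (fun j => u n j 0) (fun j => u n.+1 j 0)).
- by rewrite mulr_ge0// ltW.
- by rewrite mulr_ge0// ?subr_ge0// ltW.
- move=> i; rewrite lumped_entry//.
  have [K KT iK] := vtx_used Th (lshift nb i).
  have KP : K \in Defs.patch Th (lshift nb i) by rewrite inE KT.
  rewrite (bigD1 K)//= ltr_pwDl ?divr_gt0 ?area_elt_gt0// sumr_ge0// => L /andP[+ _].
  by rewrite inE => /andP[LT _]; rewrite divr_ge0// ltW// area_elt_gt0.
- move=> i; rewrite pmulr_rle0//.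
  apply: (load_le0 hOm hphi); first exact: fint.
  by move=> x Omx; exact: f0.
- move=> i l li; apply: (stiff_le0 hOm Dspd Dint hphi mesh) => //.
  exact: vtx_interior.
- by move=> i; exact: stiff_row_sum.
- by move=> i; exact: time_step_le.
- by move=> i; exact: lumped_scheme_row hu nN.
- by move=> l; apply: IH; exact: ltnW.
- exact: bC.
Qed.
End scheme_bounds.
Theorem theorem3p4 (R : realType) (Om : set (R * R)) (hOm : polygonal_domain Om)
  (T : R) (T_gt0 : 0 < T)
  (D : R * R -> 'M[R]_2)
  (D_spd : forall x, Om x -> spd (D x))
  (D_int : forall p q,
     (leb2 R).-integrable (closure Om) (fun x => (D x p q)%:E))
  (ni nb : nat) (Th : triangulation Om ni nb)
  (phi : 'I_(ni + nb) -> R * R -> R) (hphi : nodal_basis Th phi)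
  (theta dt : R) (theta_itv : 0 < theta <= 1) (dt_gt0 : 0 < dt)
  (N : nat) (N_ge1 : (1 <= N)%N) (NT : N%:R * dt <= T)
  (mesh_cond : delaunay_type Th D)
  (dt_cond : (dt%:E <= time_step_bound Th D theta)%E)
  (f g : R * R -> R -> R) (u0 : R * R -> R)
  (f_int : forall t, 0 < t <= T ->
     (leb2 R).-integrable (closure Om) (fun x => (f x t)%:E))
  (f_le0 : forall x t, Om x -> 0 < t <= T -> f x t <= 0)
  (u : nat -> 'cV[R]_(ni + nb))
  (hu : lumped_scheme Th phi D f g u0 theta dt N u) :
  let U n x := fem_fun phi (u n) x in
  Num.max 0 (sup [set U n x | n in [set n | (0 <= n <= N)%N] & x in closure Om])
  = Num.max 0
      (Num.max
         (sup [set U n x | n in [set n | (1 <= n <= N)%N] & x in boundary Om])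
         (sup [set U 0%N x | x in closure Om])).
Proof.
move=> U.
pose SL := [set U n x | n in [set n | (0 <= n <= N)%N] & x in closure Om].
pose SB := [set U n x | n in [set n | (1 <= n <= N)%N] & x in boundary Om].
pose S0 := [set U 0%N x | x in closure Om].
have BO : boundary Om `<=` closure Om by exact: subDsetl.
have vtxO j : closure Om (vtx Th j).
  case: (split_ordP j) => k ->; first by apply: subset_closure; exact: vtx_interior.
  by apply: BO; exact: vtx_boundary.
have Ule C n x : (forall j, u n j 0 <= C) -> closure Om x -> U n x <= C.
  by move=> uC Ox; exact: fem_fun_le uC.
(* A crude bound on all nodal values, so that each [sup] is taken over a bounded set. *)
pose M := \sum_(n < N.+1) \sum_j `|u n j 0|.
have uM n j : (n <= N)%N -> u n j 0 <= M.
  move=> nN; rewrite /M (bigD1 (Ordinal (nN : (n < N.+1)%N)))//= (bigD1 j)//=.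
  rewrite (le_trans (ler_norm _))// -addrA lerDl addr_ge0// sumr_ge0// => k _.
  exact: sumr_ge0.
have ubL : has_ubound SL.
  by exists M => _ [n nN [x Ox <-]]; apply: Ule => // j; exact: uM.
have subB : SB `<=` SL.
  by move=> _ [n /andP[_ nN] [x /BO Ox <-]]; exists n => //; exists x.
have sub0 : S0 `<=` SL by move=> _ [x Ox <-]; exists 0%N => //; exists x.
have ubB : has_ubound SB by have [m hm] := ubL; exists m => z /subB /hm.
have ub0 : has_ubound S0 by have [m hm] := ubL; exists m => z /sub0 /hm.
have [p Op] : closure Om !=set0.
  by have [_ [p Op] _ _ _] := hOm; exists p; exact: subset_closure.
have ne0 : S0 !=set0 by exists (U 0%N p), p.
have neL : SL !=set0 by have [z /sub0 hz] := ne0; exists z.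
rewrite -/SL -/SB -/S0.
apply/eqP; rewrite eq_le; apply/andP; split; last first.
  rewrite ge_max le_max lexx /= ge_max; apply/andP; split.
    (* The [sup] of an empty set is 0 by convention, which the outer maximum with 0 absorbs. *)
    have [neB|/set0P/negP/negPn/eqP ->] := pselect (SB !=set0); last by rewrite sup0 le_max lexx.
    rewrite le_max; apply/orP; right; apply: ge_sup => // z /subB.
    exact: ub_le_sup.
  rewrite le_max; apply/orP; right; apply: ge_sup => // z /sub0.
  exact: ub_le_sup.
(* The nodal bound is applied with [C] equal to the whole right-hand side: initial and boundary
   nodal values are values of [U] at vertices, hence below the corresponding suprema. *)
rewrite ge_max le_max lexx /=; apply: ge_sup => // _ [n /= nN [x Ox <-]].
apply: Ule => // j; apply: (fem_fun_nodal_bound hOm D_spd D_int hphi theta_itv dt_gt0 NT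
  mesh_cond dt_cond f_int f_le0 hu) => //.
- move=> k; rewrite !le_max; apply/orP; right; apply/orP; right.
  apply: ub_le_sup => //; exists (vtx Th k) => //.
  exact: fem_fun_vtx.
- move=> m k mN; rewrite !le_max; apply/orP; right; apply/orP; left.
  apply: ub_le_sup => //; exists m => //; exists (vtx Th (rshift ni k)).
    exact: vtx_boundary.
  exact: fem_fun_vtx.
Qed.
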